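(* There exists an absolute constant $C>0$ such that for all $h,s>0$ and all $n\ge 3$, $$\sup_{\pi\in\mathcal P([0,h])}\mathsf{Regret}_\pi(\hat f_{\mathsf{erm}})\le \frac{C\max\{1,h\}^3}{n}\Big(\frac{\log n}{\log\log n}\Big)^2,\qquad \sup_{\pi\in\mathsf{SubE}(s)}\mathsf{Regret}_\pi(\hat f_{\mathsf{erm}})\le \frac{C\max\{1,s\}^3}{n}(\log n)^3,$$ where $\hat f_{\mathsf{erm}}$ is the ERM estimator over the class of all nondecreasing functions, computed from a training sample of size $n$.
   Context: For a probability distribution $\pi$ on $[0,\infty)$, the Poisson mixture is $p_\pi(x)=\int e^{-\theta}\theta^x/x!\,d\pi(\theta)$, $x\in\mathbb Z_+=\{0,1,2,\dots\}$. The Bayes estimator is $f^*(x)=(x+1)p_\pi(x+1)/p_\pi(x)=\mathbb E[\theta\mid X=x]$. The training sample $X_1,\dots,X_n$ is i.i.d. from $p_\pi$. ERM estimator: let $\mathcal F$ be the class of nondecreasing functions $f:\mathbb Z_+\to[0,\infty)$, with the convention $f(-1)=0$. Then $\hat f_{\mathsf{erm}}$ is a minimizer over $\mathcal F$ of $\hat R(f)=\frac1n\sum_{i=1}^n\big[f(X_i)^2-2X_if(X_i-1)\big]$. Its values are uniquely determined on $S=(\{X_1,\dots,X_n\}\cup\{X_1-1,\dots,X_n-1\})\cap\mathbb Z_+$. It is extended to all of $\mathbb Z_+$ by setting $\hat f_{\mathsf{erm}}(x)=0$ for $x<\min S$ and $\hat f_{\mathsf{erm}}(x)=\hat f_{\mathsf{erm}}(\max\{y\in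 S:y\le x\})$ otherwise. Regret: $\mathsf{Regret}_\pi(\hat f)=\mathbb E[(\hat f(X)-\theta)^2]-\mathbb E[(f^*(X)-\theta)^2]$. Here $\theta\sim\pi$ and, given $\theta$, $X\sim\mathrm{Poi}(\theta)$. The pair $(\theta,X)$ is independent of the training sample, and the expectation is taken over both the test pair and the training sample. $\mathcal P([0,h])$ denotes the set of all probability distributions supported on $[0,h]$. $\mathsf{SubE}(s)=\{G \text{ distribution on }\mathbb R_+: G([t,\infty))\le 2e^{-t/s}\ \forall t>0\}$. *)

(* Defs.v *)
From HB Require Import structures.
From mathcomp Require Import all_boot all_order all_algebra.
From mathcomp Require Import all_classical all_reals all_analysis.
From mathcomp Require Import Rstruct Rstruct_topology.
Set Implicit Arguments. Unset Strict Implicit. Unset Printing Implicit Defensive.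
Import Order.TTheory GRing.Theory Num.Theory.
Import numFieldNormedType.Exports.
Local Open Scope classical_set_scope.
Local Open Scope ring_scope.

Notation RR := Rdefinitions.R.

Notation prior := (probability (measurableTypeR RR) RR).

Definition poi (t : RR) (x : nat) : RR := expR (- t) * t ^+ x / (x `!)%:R.

Definition pmix (pi : prior) (x : nat) : RR :=
  fine (\int[pi]_(t in [set t : RR | (0 <= t)%R]) (poi t x)%:E)%E.

Definition bayes (pi : prior) (x : nat) : RR :=
  x.+1%:R * pmix pi x.+1 / pmix pi x.

Definition risk (pi : prior) (g : nat -> RR) : \bar RR :=
  (\int[pi]_(t in [set t : RR | (0 <= t)%R])
      (\esum_(x in [set: nat]) ((poi t x) * (g x - t) ^+ 2)%:E))%E.

Definition inF (f : nat -> RR) : Prop :=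
  (forall x, 0 <= f x) /\ (forall x y : nat, (x <= y)%N -> f x <= f y).

(* Empirical risk (1/n) sum_i [ f(X_i)^2 - 2 X_i f(X_i - 1) ], with f(-1) = 0. *)
Definition emp_risk (n : nat) (xs : n.-tuple nat) (f : nat -> RR) : RR :=
  n%:R^-1 * \sum_(i < n)
     (f (tnth xs i) ^+ 2
      - 2 * (if tnth xs i is x'.+1 then (tnth xs i)%:R * f x' else 0)).

Definition inS (n : nat) (xs : n.-tuple nat) (y : nat) : bool :=
  (y \in xs) || (y.+1 \in xs).

(* f is the ERM estimator computed from sample xs: a minimizer of the empirical
   risk over F, extended off S by 0 below min S and by the value at the
   largest point of S below x otherwise. *)
Definition is_erm (n : nat) (xs : n.-tuple nat) (f : nat -> RR) : Prop :=
  [/\ inF f,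
      (forall g, inF g -> emp_risk xs f <= emp_risk xs g),
      (forall x, (forall y, (y <= x)%N -> ~~ inS xs y) -> f x = 0) &
      (forall x y, inS xs y -> (y <= x)%N ->
         (forall z, (y < z)%N -> (z <= x)%N -> ~~ inS xs z) -> f x = f y)].

Definition regret (n : nat) (pi : prior) (est : n.-tuple nat -> nat -> RR)
  : \bar RR :=
  ((\esum_(xs in [set: n.-tuple nat])
      ((\prod_(i < n) pmix pi (tnth xs i))%:E * risk pi (est xs)))
   - risk pi (bayes pi))%E.

Definition supp_in (h : RR) (pi : prior) : Prop :=
  pi `[0, h]%classic = 1%E.

Definition subE (s : RR) (pi : prior) : Prop :=
  pi `[0, +oo[%classic = 1%E /\
  forall t : RR, 0 < t -> (pi `[t, +oo[%classic <= (2 * expR (- (t / s)))%:E)%E.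

(* Main.v *)
(**
Write p for the mixture, b for the Bayes rule, so that (x+1) p(x+1) = b(x) p(x),
and f for the ERM.  The regret equals E sum_x p(x) (f(x) - b(x))^2.  The function
b is nondecreasing, so f does at least as well as b on the sample; with
D = f - b, empirical frequencies p^ and
Z(x) = (x+1) p^(x+1) - b(x) p^(x), this reads
  sum_x p^(x) D(x)^2 <= 2 sum_x Z(x) D(x).
The noise Z(x) is centred with variance p(x) b(x) (x+1+b(x)) / n.  Where
p^(x) >= p(x)/2, completing the square bounds p D^2 by a multiple of Z^2 / p;
elsewhere |D| is at most the truncation level M, and that event has probability
at most exp(-n p(x) / 12).  Both contributions are summed over the x with
x <= M and b(x) <= M; all other x are negligible by exponential moments of the
mixture and (Jensen) of the Bayes rule.  In the subexponential case M is of
order s log n.  When the prior lives on [0, h], b <= h, M is of order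
h log n / log log n (from E z^X <= exp(h (z - 1)) at z = log n), and the
geometric decay of p beyond 2h gives sum_x p(x) exp(-n p(x) / 12) = O(h / n).
*)
Require Import Defs.
From HB Require Import structures.
From mathcomp Require Import all_boot all_order all_algebra.
From mathcomp Require Import all_classical all_reals all_analysis.
From mathcomp Require Import Rstruct Rstruct_topology.
From mathcomp Require Import exp measurable_realfun ring lra.
Set Implicit Arguments. Unset Strict Implicit. Unset Printing Implicit Defensive.
Import Order.TTheory GRing.Theory Num.Theory.
Local Open Scope classical_set_scope.
Local Open Scope ring_scope.

(** * Expectation over an i.i.d. sample *)

(** The monotone class enters in two ways: it contains b, which yields the basic inequality, and it
    is closed under capping, which keeps the ERM below the sample maximum. The obstacle is that D
    depends on the sample, so Z D is not centred; completing the square separately at each x removes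
    D, and only second moments of Z remain. The event that p^(x) is too small is correlated with
    p^(x+1), which occurs in Z. Its indicator is therefore replaced by exp(n p(x) / 4 - N(x) / 2),
    N(x) being the count of x: this is a product over the observations and can still be integrated
    against another count. Tail masses beyond M are made O(n^-4), because truncated second moments
    lose a factor n^2 and the sum over observations loses another n. For the moment bounds, a prior
    on [0, h] is treated as subexponential with scale 2 h. Expectations are sums of nonnegative
    extended reals, so identities in which terms cancel are first arranged with nonnegative terms on
    both sides. *)

Lemma esumZl (R : realType) (T : choiceType) (I : set T) (c : R) (a : T -> \bar R) :
  0 <= c -> (forall i, (0 <= a i)%E) ->
  (\esum_(i in I) (c%:E * a i) = c%:E * \esum_(i in I) a i)%E.
Proof.
(* One direction for every factor suffices: applied with the inverse factor it gives the other. *)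
have le (k : R) (f : T -> \bar R) : 0 <= k -> (forall i, (0 <= f i)%E) ->
    (\esum_(i in I) (k%:E * f i) <= k%:E * \esum_(i in I) f i)%E.
  move=> k0 f0; apply: ge_ereal_sup => _ [/= X [finX XI] <-].
  rewrite -ge0_mule_fsumr//.
  apply: lee_pmul => //; first by rewrite fsume_ge0.
  by apply: ereal_sup_ubound; exists X.
move=> c0 a0; apply/eqP; rewrite eq_le le//=.
move: c0; rewrite [0 <= c]le_eqVlt => /orP[/eqP <-|c0].
  by rewrite mul0e; apply: esum_ge0 => i _; rewrite mul0e.
have ca0 i : (0 <= c%:E * a i)%E by rewrite mule_ge0// lee_fin ltW.
have ci : 0 <= c^-1 by rewrite invr_ge0 ltW.
have -> : (\esum_(i in I) a i = \esum_(i in I) (c^-1%:E * (c%:E * a i)))%E.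
  by apply: eq_esum => i _; rewrite muleA -EFinM mulVf ?gt_eqF// mul1e.
apply: (@le_trans _ _ (c%:E * (c^-1%:E * \esum_(i in I) (c%:E * a i)))%E).
  apply: lee_pmul => //; first by rewrite lee_fin ltW.
    by apply: esum_ge0 => i _; rewrite mule_ge0// lee_fin.
  exact: le.
by rewrite muleA -EFinM mulfV ?gt_eqF// mul1e.
Qed.

Lemma esum_prod (R : realType) (n : nat) (F : 'I_n -> nat -> R) (e : 'I_n -> R) :
  (forall i x, 0 <= F i x) ->
  (forall i, \esum_(x in [set: nat]) (F i x)%:E = (e i)%:E)%E ->
  (\esum_(xs in [set: n.-tuple nat]) (\prod_(i < n) F i (tnth xs i))%:E
   = (\prod_(i < n) e i)%:E)%E.
Proof.
elim: n F e => [|n IH] F e F0 Fe.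
  rewrite big_ord0 [X in esum X _](_ : _ = [set [tuple]]).
    by rewrite esum_set1 big_ord0.
  by apply/seteqP; split => // xs _ /=; rewrite tuple0.
rewrite (reindex_esum ([set: nat] `*`` (fun=> [set: n.-tuple nat])) _
    (fun z => [tuple of z.1 :: z.2])); last first.
  split => //=.
    by move=> [x xs] [y ys] _ _ /= [-> ?]; congr pair; apply/val_inj.
  move=> xs _; exists (thead xs, [tuple of behead xs]) => //=.
  by rewrite [RHS]tuple_eta.
rewrite -(@esum_esum _ _ _ _ _ (fun x (xs : n.-tuple nat) =>
  (\prod_(i < n.+1) F i (tnth [tuple of x :: xs] i))%:E)); last first.
  by move=> *; rewrite lee_fin; apply: prodr_ge0.
have pF0 (xs : n.-tuple nat) :
   (0 <= (\prod_(j < n) F (lift ord0 j) (tnth xs j))%:E)%E.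
  by rewrite lee_fin; apply: prodr_ge0.
transitivity (\esum_(x in [set: nat]) ((F ord0 x)%:E *
    (\prod_(i < n) e (lift ord0 i))%:E))%E.
  apply: eq_esum => x _.
  rewrite -(IH (fun i => F (lift ord0 i)))// -esumZl//.
  apply: eq_esum => xs _; rewrite big_ord_recl -EFinM; congr (_ * _)%:E.
  by apply: eq_bigr => i _; rewrite tnthS.
under eq_esum do rewrite muleC.
rewrite esumZl//; last 2 first.
- apply: prodr_ge0 => i _; rewrite -lee_fin -Fe.
  by apply: esum_ge0 => x _; rewrite lee_fin.
- by move=> x; rewrite lee_fin.
by rewrite Fe -EFinM big_ord_recl mulrC.
Qed.

Section SampleExpectation.
Context {R : realType} {p : nat -> R}.
Hypothesis p_ge0 : forall x, 0 <= p x.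
Hypothesis p_sum1 : (\esum_(x in [set: nat]) (p x)%:E = 1)%E.

Definition wt n (xs : n.-tuple nat) : R := \prod_(i < n) p (tnth xs i).

Definition expect n (g : n.-tuple nat -> R) : \bar R :=
  (\esum_(xs in [set: n.-tuple nat]) (wt xs * g xs)%:E)%E.

Lemma wt_ge0 n (xs : n.-tuple nat) : 0 <= wt xs.
Proof. exact: prodr_ge0. Qed.

Lemma expect_ge0 n (g : n.-tuple nat -> R) :
  (forall xs, 0 <= g xs) -> (0 <= expect g)%E.
Proof.
by move=> g0; apply: esum_ge0 => xs _; rewrite lee_fin mulr_ge0// wt_ge0.
Qed.

Lemma expectD n (g h : n.-tuple nat -> R) :
  (forall xs, 0 <= g xs) -> (forall xs, 0 <= h xs) ->
  (expect (fun xs => (g xs + h xs)%R) = expect g + expect h)%E.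
Proof.
move=> g0 h0; rewrite /expect -esumD; first last.
- by move=> xs _; rewrite lee_fin mulr_ge0// wt_ge0.
- by move=> xs _; rewrite lee_fin mulr_ge0// wt_ge0.
by apply: eq_esum => xs _; rewrite mulrDr EFinD.
Qed.

Lemma expectZ n (c : R) (g : n.-tuple nat -> R) :
  0 <= c -> (forall xs, 0 <= g xs) ->
  (expect (fun xs => (c * g xs)%R) = c%:E * expect g)%E.
Proof.
move=> c0 g0; rewrite /expect -esumZl//.
  by apply: eq_esum => xs _; rewrite mulrCA EFinM.
by move=> xs; rewrite lee_fin mulr_ge0// wt_ge0.
Qed.

Lemma expect_sum n (I : choiceType) (r : seq I) (P : pred I)
    (g : I -> n.-tuple nat -> R) :
  (forall i xs, P i -> 0 <= g i xs) ->
  (expect (fun xs => (\sum_(i <- r | P i) g i xs)%R)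
   = \sum_(i <- r | P i) expect (g i))%E.
Proof.
move=> g0; rewrite /expect -(@esum_sum _ _ _ _ _ _ (fun xs i => (wt xs * g i xs)%:E)); last first.
  by move=> xs i _ Pi; rewrite lee_fin mulr_ge0 ?wt_ge0// g0.
by apply: eq_esum => xs _; rewrite mulr_sumr -sumEFin.
Qed.

Lemma expect_prod n (g : 'I_n -> nat -> R) (e : 'I_n -> R) :
  (forall i x, 0 <= g i x) ->
  (forall i, \esum_(x in [set: nat]) (p x * g i x)%:E = (e i)%:E)%E ->
  expect (fun xs => \prod_(i < n) g i (tnth xs i)) = (\prod_(i < n) e i)%:E.
Proof.
move=> g0 ge; rewrite -(@esum_prod _ _ (fun i x => p x * g i x))//; last first.
  by move=> i x; rewrite mulr_ge0.
by apply: eq_esum => xs _; rewrite -big_split.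
Qed.

Lemma expect1 n : expect (fun xs : n.-tuple nat => 1) = 1%E.
Proof.
rewrite -[1%E](_ : (\prod_(i < n) (1 : R))%:E = _); last by rewrite big1.
rewrite -(@expect_prod _ (fun _ _ => 1))//.
  by congr expect; apply/funext => xs; rewrite big1.
by move=> i; under eq_esum do rewrite mulr1.
Qed.

Lemma expect_coord n (i : 'I_n) (g : nat -> R) (e : R) :
  (forall x, 0 <= g x) -> (\esum_(x in [set: nat]) (p x * g x)%:E = e%:E)%E ->
  expect (fun xs : n.-tuple nat => g (tnth xs i)) = e%:E.
Proof.
move=> g0 ge.
have := @expect_prod n (fun j x => if j == i then g x else 1)
  (fun j => if j == i then e else 1).
rewrite -big_mkcond big_pred1_eq => <-.
- congr expect; apply/funext => xs.
  by rewrite -big_mkcond big_pred1_eq.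
- by move=> j x; case: ifP.
- move=> j; case: ifP => // _.
  by under eq_esum do rewrite mulr1.
Qed.

Lemma expect_coord2 n (i j : 'I_n) (g h : nat -> R) (e f : R) : i != j ->
  (forall x, 0 <= g x) -> (forall x, 0 <= h x) ->
  (\esum_(x in [set: nat]) (p x * g x)%:E = e%:E)%E ->
  (\esum_(x in [set: nat]) (p x * h x)%:E = f%:E)%E ->
  expect (fun xs : n.-tuple nat => g (tnth xs i) * h (tnth xs j)) = (e * f)%:E.
Proof.
move=> ij g0 h0 ge hf.
have pE (u v : R) : \prod_(k < n) (if k == i then u else if k == j then v else 1)
    = u * v.
  have ji : j != i by rewrite eq_sym.
  rewrite (bigD1 i)//= eqxx (bigD1 j)//= (negbTE ji) eqxx big1 ?mulr1// => k /andP[/negbTE -> /negbTE ->]//.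
rewrite -pE -(@expect_prod n (fun k x => if k == i then g x else if k == j then h x else 1)).
- congr expect; apply/funext => xs; rewrite -pE.
  by apply: eq_bigr => k _; case: eqP => [->//|_]; case: eqP => [->|].
- by move=> k x; case: ifP => // _; case: ifP.
- move=> k; case: ifP => // _; case: ifP => // _.
  by under eq_esum do rewrite mulr1.
Qed.

Lemma expect_pow n (h : nat -> R) (f : R) :
  (forall x, 0 <= h x) -> (\esum_(x in [set: nat]) (p x * h x)%:E = f%:E)%E ->
  expect (fun xs : n.-tuple nat => \prod_(j < n) h (tnth xs j)) = (f ^+ n)%:E.
Proof.
move=> h0 hf; rewrite (@expect_prod n (fun=> h) (fun=> f))//.
by rewrite prodr_const card_ord.
Qed.

(** Both factors meet at coordinate i, so [e] is the mean of their product there, and the other n -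
    1 coordinates contribute [f] each. *)
Lemma expect_coord_pow n (i : 'I_n) (g h : nat -> R) (e f : R) :
  (forall x, 0 <= g x) -> (forall x, 0 <= h x) ->
  (\esum_(x in [set: nat]) (p x * (g x * h x))%:E = e%:E)%E ->
  (\esum_(x in [set: nat]) (p x * h x)%:E = f%:E)%E ->
  expect (fun xs : n.-tuple nat => g (tnth xs i) * \prod_(j < n) h (tnth xs j))
  = (e * f ^+ n.-1)%:E.
Proof.
move=> g0 h0 ge hf.
have := @expect_prod n (fun k x => if k == i then g x * h x else h x)
   (fun k => if k == i then e else f).
rewrite (bigD1 i)//= eqxx (eq_bigr (fun=> f)); last by move=> k /negbTE ->.
rewrite prodr_const cardC1 card_ord => <-.
- congr expect; apply/funext => xs; rewrite [in RHS](bigD1 i)//= eqxx (bigD1 i)//=.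
  rewrite mulrA; congr (_ * _).
  by apply: eq_bigr => k /negbTE ->.
- by move=> k x; case: ifP => // _; rewrite mulr_ge0.
- by move=> k; case: ifP.
Qed.

Lemma expect_sum2 n (u v : nat -> R) (a b c : R) :
  (forall x, 0 <= u x) -> (forall x, 0 <= v x) ->
  (\esum_(x in [set: nat]) (p x * u x)%:E = a%:E)%E ->
  (\esum_(x in [set: nat]) (p x * v x)%:E = b%:E)%E ->
  (\esum_(x in [set: nat]) (p x * (u x * v x))%:E = c%:E)%E ->
  expect (fun xs : n.-tuple nat =>
    (\sum_(i < n) u (tnth xs i)) * (\sum_(j < n) v (tnth xs j)))
  = (n%:R * c + n%:R * (n%:R - 1) * (a * b))%:E.
Proof.
move=> u0 v0 ua vb uvc.
rewrite [expect _](_ : _ = expect (fun xs : n.-tuple nat =>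
    \sum_(i < n) \sum_(j < n) u (tnth xs i) * v (tnth xs j))); last first.
  congr expect; apply/funext => xs; rewrite mulr_suml.
  by apply: eq_bigr => i _; rewrite mulr_sumr.
have uv0 (x y : nat) : 0 <= u x * v y by rewrite mulr_ge0.
rewrite expect_sum; last by move=> i xs _; apply: sumr_ge0.
rewrite (eq_bigr (fun i : 'I_n => (c + (n%:R - 1) * (a * b))%:E)); last first.
  move=> i _; rewrite expect_sum// (bigD1 i)//=.
  rewrite (@expect_coord n i (fun x => u x * v x) c)//.
  rewrite (eq_bigr (fun j : 'I_n => (a * b)%:E)); last first.
    by move=> j ji; apply: expect_coord2 => //; rewrite eq_sym.
  rewrite sumEFin -EFinD sumr_const cardC1 card_ord; congr (_ + _)%:E.
  case: n i => [[]//|m] i /=.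
  by rewrite -natr1 addrK mulr_natl.
rewrite sumEFin sumr_const card_ord; congr EFin; rewrite -mulr_natl; ring.
Qed.

End SampleExpectation.

(** * Moments of empirical counts *)

Lemma esum_lt (R : realType) (K : nat) (F : nat -> R) : (forall x, 0 <= F x) ->
  (\esum_(x in [set: nat]) (if (x < K)%N then F x else 0)%:E
   = (\sum_(x < K) F x)%:E)%E.
Proof.
move=> F0; rewrite -nneseries_esumT; last by move=> x; rewrite lee_fin; case: ifP.
rewrite (nneseries_split 0 K); last by move=> x _; rewrite lee_fin; case: ifP.
rewrite add0n eseries0 ?adde0; last by move=> x /= Kx _; rewrite ltnNge Kx.
rewrite big_mkord sumEFin; congr EFin; apply: eq_bigr => x _.
by rewrite ltn_ord.
Qed.

Lemma esum_pred1 (R : realType) (F : nat -> R) (a : nat) : 0 <= F a ->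
  (\esum_(x in [set: nat]) (F x * (x == a)%:R)%:E = (F a)%:E)%E.
Proof.
move=> Fa; rewrite -[RHS](@esum_set1 _ _ a (fun x => (F x)%:E)) ?lee_fin// [RHS]esum_mkcond.
apply: eq_esum => x _; case: ifPn => [/set_mem ->|/negP xa].
  by rewrite eqxx mulr1.
by case: eqP => [xE|_]; rewrite ?mulr0//; case: xa; rewrite xE inE.
Qed.

Section CountMoments.
Context {R : realType} {p : nat -> R}.
Hypothesis p_ge0 : forall x, 0 <= p x.
Hypothesis p_sum1 : (\esum_(x in [set: nat]) (p x)%:E = 1)%E.

Definition cnt n (xs : n.-tuple nat) (x : nat) : R :=
  \sum_(i < n) (tnth xs i == x)%:R.

Let cnt_ge0 n (xs : n.-tuple nat) x : 0 <= cnt xs x.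
Proof. by apply: sumr_ge0 => i _; rewrite ler0n. Qed.

Lemma pmf_le1 x : p x <= 1.
Proof.
rewrite -lee_fin -p_sum1; apply: esum_ge; exists [set x]; first by split.
by rewrite fsbig_set1.
Qed.

Let expect_cnt2 n (x y : nat) (c : R) :
  (\esum_(z in [set: nat]) (p z * ((z == x)%:R * (z == y)%:R))%:E = c%:E)%E ->
  expect (p := p) (fun xs : n.-tuple nat => cnt xs x * cnt xs y)
  = (n%:R * c + n%:R * (n%:R - 1) * (p x * p y))%:E.
Proof.
move=> pc; apply: (@expect_sum2 R p p_ge0 p_sum1 n (fun z => (z == x)%:R)
  (fun z => (z == y)%:R)) => // *; rewrite ?ler0n//; exact: esum_pred1.
Qed.

(* The variance is expanded into nonnegative terms only, since [expect] is an
   [esum], meaningful for nonnegative functions. *)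
Lemma expect_cnt_var n (x y : nat) (a b : R) : x != y -> 0 <= a -> 0 <= b ->
  a * p x = b * p y ->
  expect (p := p) (fun xs : n.-tuple nat => (a * cnt xs x - b * cnt xs y) ^+ 2)
  = (n%:R * (a ^+ 2 * p x + b ^+ 2 * p y))%:E.
Proof.
move=> xy a0 b0 ab.
have Edd z : expect (p := p) (fun xs : n.-tuple nat => cnt xs z * cnt xs z)
    = (n%:R * p z + n%:R * (n%:R - 1) * (p z * p z))%:E.
  apply: expect_cnt2; rewrite -(esum_pred1 (F := p) (a := z))//.
  by apply: eq_esum => w _; case: eqP => _; rewrite ?mulr1 ?mulr0.
have Exy : expect (p := p) (fun xs : n.-tuple nat => cnt xs x * cnt xs y)
    = (n%:R * 0 + n%:R * (n%:R - 1) * (p x * p y))%:E.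
  apply: expect_cnt2; apply: esum1 => w _.
  case: (w =P x) => [->|_]; last by rewrite mul0r mulr0.
  by rewrite (negbTE xy) !mulr0.
have split2 : (expect (p := p)
     (fun xs : n.-tuple nat => ((a * cnt xs x - b * cnt xs y) ^+ 2)%R)
   + expect (p := p) (fun xs : n.-tuple nat => (2 * a * b * (cnt xs x * cnt xs y))%R)
   = expect (p := p) (fun xs : n.-tuple nat => (a ^+ 2 * (cnt xs x * cnt xs x))%R)
   + expect (p := p) (fun xs : n.-tuple nat => (b ^+ 2 * (cnt xs y * cnt xs y))%R))%E.
  rewrite -!expectD//; try by move=> xs; rewrite ?sqr_ge0 ?mulr_ge0.
  by congr expect; apply/funext => xs; ring.
move: split2; rewrite !expectZ//; try by move=> *; rewrite ?mulr_ge0 ?exprn_ge0.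
rewrite Exy !Edd -!EFinM -EFinD => /eqP; rewrite eq_sym -sube_eq//=; last first.
  by rewrite fin_num_adde_defl.
rewrite -EFinB => /eqP <-; congr EFin.
(* The terms carrying n (n - 1) assemble into the square of a p(x) - b p(y), which is zero by
   [ab]. *)
have -> : a ^+ 2 * (n%:R * p x + n%:R * (n%:R - 1) * (p x * p x))
   = a ^+ 2 * n%:R * p x + n%:R * (n%:R - 1) * (a * p x) ^+ 2 by ring.
have -> : 2 * a * b * (n%:R * 0 + n%:R * (n%:R - 1) * (p x * p y))
   = 2 * n%:R * (n%:R - 1) * (a * p x) * (b * p y) by ring.
by rewrite ab; ring.
Qed.

(** The Chernoff weight of one observation y: the product over the sample is exp(-N(x) / 2), and
    [f x] below is the mean of one factor. *)
Let h (x y : nat) : R := expR (- ((y == x)%:R / 2)).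

Let hE n (xs : n.-tuple nat) x :
  expR (- (cnt xs x / 2)) = \prod_(j < n) h x (tnth xs j).
Proof. by rewrite /h -expR_sum sumrN /cnt mulr_suml. Qed.

Let f x : R := 1 - (1 - expR (- (1 / 2))) * p x.

Let half_ge : 1 / 3 <= 1 - expR (- (1 / 2)) :> R.
Proof.
have h32 : 3 / 2 <= expR (1 / 2) :> R by apply: le_trans (expR_ge1Dx _); lra.
have : expR (1 / 2) * expR (- (1 / 2)) = 1 :> R by rewrite expRxMexpNx_1.
have := expR_gt0 (- (1 / 2) : R); nra.
Qed.

Let f_ge0 x : 0 <= f x.
Proof.
rewrite /f subr_ge0 mulr_ile1 ?pmf_le1// subr_ge0.
Qed.

Let f_le x : f x <= expR (- (p x / 3)).
Proof.
apply: le_trans (expR_ge1Dx _); rewrite /f.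
have := p_ge0 x; have := half_ge; nra.
Qed.

Let esum_h x : (\esum_(y in [set: nat]) (p y * h x y)%:E = (f x)%:E)%E.
Proof.
have ph y : 0 <= p y * h x y by rewrite mulr_ge0 ?expR_ge0.
have g0 : 0 <= 1 - expR (- (1 / 2)) :> R.
  by apply: le_trans half_ge; rewrite divr_ge0.
have : (\esum_(y in [set: nat]) ((p y * h x y)%:E
   + ((1 - expR (- (1 / 2))) * p y * (y == x)%:R)%:E)
   = \esum_(y in [set: nat]) (p y)%:E)%E.
  apply: eq_esum => y _; rewrite -EFinD; congr EFin; rewrite /h.
  case: eqP => _; first by rewrite mulr1n; ring.
  by rewrite mulr0n mul0r oppr0 expR0; ring.
rewrite esumD//; last 2 first.
- by move=> y _; rewrite lee_fin.
- by move=> y _; rewrite lee_fin !mulr_ge0.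
rewrite (esum_pred1 (F := fun y => (1 - expR (- (1 / 2))) * p y)) ?mulr_ge0//.
rewrite p_sum1 => /eqP; rewrite eq_sym -sube_eq//; last by rewrite fin_num_adde_defl.
by rewrite -EFinB => /eqP <-.
Qed.

(** The integrand is at least 1 when N(x) <= n p(x) / 2, so this is a Chernoff bound for that event.
    The rate is 1/12 = 1/3 - 1/4, where 1/3 comes from 1 - exp(-1/2) >= 1/3. *)
Lemma expect_expcnt n x :
  (expect (p := p) (fun xs : n.-tuple nat => expR (n%:R * p x / 4 - cnt xs x / 2)%R)
   <= (expR (- (n%:R * p x / 12)))%:E)%E.
Proof.
rewrite [expect _](_ : _ = expect (p := p) (fun xs : n.-tuple nat =>
   expR (n%:R * p x / 4) * \prod_(j < n) h x (tnth xs j))); last first.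
  by congr expect; apply/funext => xs; rewrite expRD hE.
have h0 y : 0 <= h x y by rewrite expR_ge0.
rewrite expectZ ?expR_ge0//; last by move=> xs; apply: prodr_ge0.
rewrite (@expect_pow R p p_ge0 n (h x) (f x) h0 (esum_h x)) -EFinM lee_fin.
apply: (@le_trans _ _ (expR (n%:R * p x / 4) * expR (- (p x / 3)) ^+ n)).
  by rewrite ler_wpM2l ?expR_ge0// lerXn2r// nnegrE ?expR_ge0.
by rewrite -expRM_natl -expRD ler_expR; lra.
Qed.

(** Serves with y = x + 1. An observation equal to y differs from x, so its Chernoff factor is 1 and
    n - 1 factors [f x] remain. *)
Lemma expect_cnt_expcnt n (x y : nat) : x != y ->
  (expect (p := p) (fun xs : n.-tuple nat =>
     (cnt xs y * expR (n%:R * p x / 4 - cnt xs x / 2))%R)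
   <= (2 * n%:R * p y * expR (- (n%:R * p x / 12)))%:E)%E.
Proof.
move=> xy.
rewrite [expect _](_ : _ = expect (p := p) (fun xs : n.-tuple nat =>
   expR (n%:R * p x / 4) *
   \sum_(i < n) (tnth xs i == y)%:R * \prod_(j < n) h x (tnth xs j))); last first.
  congr expect; apply/funext => xs; rewrite expRD hE -mulr_suml.
  by rewrite mulrCA.
have h0 z : 0 <= h x z by rewrite expR_ge0.
have t0 (i : 'I_n) (xs : n.-tuple nat) :
    0 <= (tnth xs i == y)%:R * \prod_(j < n) h x (tnth xs j).
  by rewrite mulr_ge0 ?ler0n// prodr_ge0.
rewrite expectZ ?expR_ge0//; last by move=> xs; apply: sumr_ge0.
rewrite expect_sum//.
rewrite (eq_bigr (fun=> (p y * f x ^+ n.-1)%:E)); last first.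
  move=> i _; apply: (@expect_coord_pow R p p_ge0 n i (fun z => (z == y)%:R) (h x)) => //.
    rewrite -[RHS](esum_pred1 (F := p))//; apply: eq_esum => z _.
    case: (z =P y) => [->|_]; rewrite ?mul0r ?mulr0// mul1r mulr1.
    by rewrite /h eq_sym (negbTE xy) mul0r oppr0 expR0 mulr1.
rewrite sumEFin sumr_const card_ord -EFinM lee_fin.
case: n {t0} => [|n] /=; first by rewrite !(mulr0n, mulr0, mul0r).
rewrite -[(p y * _) *+ _]mulr_natl.
(* Restoring the missing factor costs exp(p(x) / 3) <= 1 / (1 - p(x) / 3) <= 3/2, rounded up to
   2. *)
have fn : f x ^+ n <= 2 * expR (- (n.+1%:R * p x / 3)).
  apply: (@le_trans _ _ (expR (p x / 3) * expR (- (n.+1%:R * p x / 3)))).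
    rewrite -expRD (_ : _ + _ = n%:R * (- (p x / 3))); last by rewrite -natr1; lra.
    by rewrite expRM_natl lerXn2r// nnegrE ?expR_ge0.
  rewrite ler_wpM2r ?expR_ge0//.
  have m1 : 1 - p x / 3 <= expR (- (p x / 3)) by rewrite expR_ge1Dx.
  have : expR (p x / 3) * expR (- (p x / 3)) = 1 by rewrite expRxMexpNx_1.
  have := expR_gt0 (p x / 3); have := p_ge0 x; have := pmf_le1 x; nra.
rewrite [leLHS](_ : _ = n.+1%:R * p y * (expR (n.+1%:R * p x / 4) * f x ^+ n)); last by ring.
rewrite [leRHS](_ : _ = n.+1%:R * p y * (2 * expR (- (n.+1%:R * p x / 12)))); last by ring.
rewrite ler_wpM2l ?mulr_ge0//.
apply: (@le_trans _ _ (expR (n.+1%:R * p x / 4) * (2 * expR (- (n.+1%:R * p x / 3))))).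
  by rewrite ler_wpM2l ?expR_ge0.
rewrite mulrCA -expRD ler_wpM2l// ler_expR; lra.
Qed.

End CountMoments.

(** * Empirical risk minimizers *)

Lemma emp_risk_leE n (xs : n.-tuple nat) (f g : nat -> RR) :
  emp_risk xs f <= emp_risk xs g ->
  \sum_(i < n) (f (tnth xs i) ^+ 2 - g (tnth xs i) ^+ 2
    - 2 * (if tnth xs i is x'.+1 then (tnth xs i)%:R * (f x' - g x') else 0))
  <= 0.
Proof.
rewrite /emp_risk; case: (posnP n) => [n0|n0].
  by move=> _; apply: sumr_le0 => i; move: (ltn_ord i); rewrite {2}n0.
rewrite ler_pM2l ?invr_gt0 ?ltr0n// -subr_le0 -sumrB.
congr (is_true (_ <= _)); apply: eq_bigr => i _.
by case: (tnth xs i) => [|x]; ring.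
Qed.

(* Compare [f] with [min f m]: as [X_i <= m], truncation lowers the empirical
   risk by at least [sum_i (f - min f m)(X_i)^2]. *)
Lemma erm_le_max n (xs : n.-tuple nat) (f : nat -> RR) (m : nat) :
  is_erm xs f -> (forall i, (tnth xs i <= m)%N) -> forall x, f x <= m%:R.
Proof.
move=> [[f0 fmon] fmin flo fext] xm.
pose g x := Num.min (f x) m%:R.
have gF : inF g.
  split=> [x|x y xy]; rewrite /g; first by rewrite le_min f0 ler0n.
  by rewrite le_min ge_min fmon//= ge_min lexx orbT.
have gle x : g x <= f x by rewrite ge_min lexx.
have term i : (f (tnth xs i) - g (tnth xs i)) ^+ 2 <=
   f (tnth xs i) ^+ 2 - g (tnth xs i) ^+ 2
   - 2 * (if tnth xs i is x'.+1 then (tnth xs i)%:R * (f x' - g x') else 0).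
  have := xm i; case: (tnth xs i) => [|x] xlem.
    have := gle 0; have := f0 0; have := gF.1 0; nra.
  have xR : (x.+1)%:R <= m%:R :> RR by rewrite ler_nat.
  have x0 : 0 <= (x.+1)%:R :> RR by rewrite ler0n.
  have fx := fmon x x.+1 (leqnSn x).
  have gx := gle x; have f0x := f0 x.
  have [fm|fm] := leP (f x.+1) m%:R.
    have gE y : f y <= m%:R -> g y = f y by move=> fy; apply/min_idPl.
    rewrite !gE//; last by apply: le_trans fm.
    by rewrite !subrr !mulr0 subr0 expr0n.
  have gm : g x.+1 = m%:R by apply/min_idPr/ltW.
  have ux : f x - g x <= f x.+1 - m%:R.
    by rewrite /g; case: (leP (f x)) => ?; lra.
  rewrite gm; nra.
have S0 := emp_risk_leE (fmin _ gF).
(* The sum of squares lies below a risk difference that is at most 0, so capping changes nothing at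
   the observations. Monotonicity then covers their predecessors, and the extension rule the
   remaining points. *)
have fs i : f (tnth xs i) <= m%:R.
  have sq0 : \sum_(i < n) (f (tnth xs i) - g (tnth xs i)) ^+ 2 = 0.
    apply/eqP; rewrite eq_le sumr_ge0 ?andbT; last by move=> j _; exact: sqr_ge0.
    by apply: le_trans S0; apply: ler_sum => j _; exact: term.
  move/eqP: sq0; rewrite psumr_eq0; last by move=> j _; exact: sqr_ge0.
  move=> /allP /(_ i); rewrite mem_index_enum => /(_ isT) /=.
  by rewrite sqrf_eq0 subr_eq0 => /eqP ->; rewrite /g ge_min lexx orbT.
have fS y : inS xs y -> f y <= m%:R.
  move=> /orP[/tnthP[i ->]|/tnthP[i yi]]; first exact: fs.
  by apply: le_trans (fs i); apply: fmon; rewrite -yi.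
move=> x; have [/existsP[[y /= yx] Sy]|] := boolP [exists y : 'I_x.+1, inS xs y].
  have ex : exists y, inS xs y && (y <= x)%N by exists y; rewrite Sy.
  have [|z /andP[Sz zx] zmax] := ex_maxnP ex (m := x); first by move=> ? /andP[].
  rewrite (fext x z)//; first exact: fS.
  move=> w zw wx; apply/negP => Sw.
  by have := zmax w; rewrite Sw wx => /(_ isT); rewrite leqNgt zw.
move=> /existsPn noS; rewrite flo ?ler0n// => y yx.
by have := noS (Ordinal (yx : (y < x.+1)%N)).
Qed.

Local Notation count_at := (@cnt RR _).

Lemma sum_count_at n (xs : n.-tuple nat) (K : nat) (F : nat -> RR) :
  (forall i, (tnth xs i < K)%N) ->
  \sum_(i < n) F (tnth xs i) = \sum_(x < K) count_at xs x * F x.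
Proof.
move=> xK; under [RHS]eq_bigr do rewrite mulr_suml.
rewrite exchange_big /=; apply: eq_bigr => i _.
rewrite (bigD1 (Ordinal (xK i)))//= eqxx mul1r big1 ?addr0// => x /eqP xi.
by case: eqP => [E|_]; rewrite ?mul0r//; case: xi; exact/val_inj.
Qed.

(** Writing f = b + D, the quadratic part gives D^2 + 2 b D at each observation, and the linear
    part, regrouped by X_i - 1, gives (x + 1) N(x+1) D(x). *)
Lemma erm_basic_ineq n (xs : n.-tuple nat) (f b : nat -> RR) (K : nat) :
  is_erm xs f -> inF b -> (forall i, (tnth xs i < K)%N) ->
  \sum_(x < K) (count_at xs x * (f x - b x) ^+ 2
    - 2 * (x.+1%:R * count_at xs x.+1 - count_at xs x * b x) * (f x - b x)) <= 0.
Proof.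
move=> [_ fmin _ _] bF xK; apply: le_trans (emp_risk_leE (fmin _ bF)).
pose D x := f x - b x.
pose G x : RR := if x is x'.+1 then x%:R * D x' else 0.
have GE : \sum_(i < n) G (tnth xs i) = \sum_(x < K) x.+1%:R * count_at xs x.+1 * D x.
  (* One extra index makes room for the shift: the term at 0 vanishes by the convention f(-1) = 0,
     and K terms are left. *)
  rewrite (@sum_count_at _ _ K.+1); last by move=> i; apply: ltnW; rewrite ltnS.
  rewrite big_ord_recl mulr0 add0r; apply: eq_bigr => x _ /=.
  by rewrite /G /bump /= add1n; ring.
rewrite [leRHS](_ : _ = \sum_(i < n) (D (tnth xs i) ^+ 2
   + 2 * b (tnth xs i) * D (tnth xs i)) - 2 * \sum_(i < n) G (tnth xs i)); last first.
  rewrite mulr_sumr -sumrB; apply: eq_bigr => i _.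
  by rewrite /G /D; case: (tnth xs i) => [|x]; ring.
rewrite GE (sum_count_at (fun x => D x ^+ 2 + 2 * b x * D x) xK) mulr_sumr -sumrB.
by apply: ler_sum => x _; rewrite /D le_eqVlt; apply/orP; left; apply/eqP; ring.
Qed.

(* If the empirical mass [N / n] is at least [p / 2], the offset [N D^2] absorbs
   [p D^2] and leaves a squared noise term; otherwise [E >= 1] pays for the crude
   bound [|D| <= M].  At [p = 0] the division gives [0]. *)
Lemma pointwise_offset (R : realType) (p N W b D M n E : R) :
  0 < n -> 0 <= p -> 0 <= N -> 0 <= W -> 0 <= b <= M -> `|D| <= M -> 0 <= E ->
  (p = 0 -> N = 0 /\ W = 0) -> (N <= n * p / 2 -> 1 <= E) ->
  p * D ^+ 2 <= 4 / n * (N * D ^+ 2 - 2 * (W - N * b) * D)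
    + (16 / n ^+ 2 * ((W - N * b) ^+ 2 / p)
       + (5 * M ^+ 2 * p * E + 8 * M / n * (W * E))).
Proof.
move=> n0 p0 N0 W0 /andP[b0 bM] DM E0 pN NE.
have M0 : 0 <= M by apply: le_trans bM.
have [pz|pnz] := eqVneq p 0.
  by have [-> ->] := pN pz; rewrite pz !(mul0r, mulr0, subr0, addr0, invr0).
have {p0 pnz}p0 : 0 < p by rewrite lt_neqAle eq_sym pnz.
have nI : 0 < n^-1 by rewrite invr_gt0.
set nu := N / n; set om := W / n; set Z := om - nu * b.
have nu0 : 0 <= nu by rewrite mulr_ge0// ltW.
have om0 : 0 <= om by rewrite mulr_ge0// ltW.
rewrite [leRHS](_ : _ = 4 * (nu * D ^+ 2 - 2 * Z * D) + (16 * (Z ^+ 2 / p)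
   + (5 * M ^+ 2 * p * E + 8 * M * om * E))); last first.
  by rewrite /Z /nu /om; field; rewrite !gt_eqF.
have Q0 : 0 <= Z ^+ 2 / p by rewrite mulr_ge0 ?sqr_ge0// invr_ge0 ltW.
have MM : 0 <= 5 * M ^+ 2 * p * E.
  by do ?apply: mulr_ge0 => //; rewrite ltW.
have Mo : 0 <= 8 * M * om * E.
  by do ?apply: mulr_ge0 => //.
have [Nsmall|Nbig] := leP N (n * p / 2).
  have E1 := NE Nsmall.
  have nup : nu <= p / 2 by rewrite ler_pdivrMr//; lra.
  move: DM; rewrite ler_norml => /andP[D1 D2].
  (* Origin of 5 and 8: four times this bound is 8 M om + 4 p M^2, and p D^2 <= p M^2 adds the fifth
     p M^2. *)
  have ZD : 2 * Z * D <= 2 * (om + p / 2 * M) * M.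
    have ZM : `|Z| <= om + p / 2 * M.
      have : nu * b <= p / 2 * M by apply: ler_pM.
      have : 0 <= nu * b by rewrite mulr_ge0.
      by rewrite ler_norml /Z; lra.
    have := ler_norm (Z * D); rewrite normrM.
    have : `|Z| * `|D| <= (om + p / 2 * M) * M.
      by apply: ler_pM => //; rewrite ler_norml D1.
    lra.
  have DD : p * D ^+ 2 <= p * M ^+ 2.
    by rewrite ler_pM2l// -[D ^+ 2]real_normK ?num_real// lerXn2r ?nnegrE// ler_norml D1.
  have nD : 0 <= nu * D ^+ 2 by rewrite mulr_ge0// sqr_ge0.
  have E5 : 5 * M ^+ 2 * p * 1 <= 5 * M ^+ 2 * p * E.
    by apply: ler_wpM2l => //; do ?apply: mulr_ge0 => //; rewrite ltW.
  have E8 : 8 * M * om * 1 <= 8 * M * om * E.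
    by apply: ler_wpM2l => //; do ?apply: mulr_ge0 => //.
  lra.
have nup : p / 2 <= nu by rewrite ler_pdivlMr//; lra.
(* The prefactor 4 makes the offset at least 2 p D^2; one p D^2 pays for the cross term 8 Z D, the
   other is the quantity to be bounded. *)
have AM : 8 * Z * D <= p * D ^+ 2 + 16 * (Z ^+ 2 / p).
  rewrite -subr_ge0 (_ : _ - _ = p * (D - 4 * Z / p) ^+ 2).
    by rewrite mulr_ge0 ?sqr_ge0// ltW.
  by field; rewrite gt_eqF.
have : p / 2 * D ^+ 2 <= nu * D ^+ 2 by rewrite ler_wpM2r ?sqr_ge0.
lra.
Qed.

(** * The expected excess loss *)

Section Core.
Variables (p b : nat -> RR) (n K : nat) (M q tx tb m2 : RR).
Hypothesis p_ge0 : forall x, 0 <= p x.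
Hypothesis p_sum1 : (\esum_(x in [set: nat]) (p x)%:E = 1)%E.
Hypothesis bF : inF b.
Hypothesis pS : forall x, x.+1%:R * p x.+1 = b x * p x.
Hypothesis n_gt0 : (0 < n)%N.
Hypothesis M_ge0 : 0 <= M.
Hypothesis K_le : forall x, (x < K)%N -> x%:R <= M.
Hypothesis b_le : forall x, (x < K)%N -> b x <= M.
Hypothesis qE : (\esum_(x in [set: nat]) (p x * (K <= x)%:R)%:E = q%:E)%E.
Hypothesis txE :
  (\esum_(x in [set: nat]) (p x * (x%:R ^+ 2 * (K <= x)%:R))%:E = tx%:E)%E.
Hypothesis tbE :
  (\esum_(x in [set: nat]) (p x * b x ^+ 2 * (K <= x)%:R)%:E = tb%:E)%E.
Hypothesis m2E : (\esum_(x in [set: nat]) (p x * b x ^+ 2)%:E = m2%:E)%E.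

Let b_ge0 x : 0 <= b x. Proof. by case: bF. Qed.

Let n_pos : 0 < n%:R :> RR. Proof. by rewrite ltr0n. Qed.

Let sqr_le_of_ge0 (a c m : RR) :
  0 <= a <= m -> 0 <= c -> (a - c) ^+ 2 <= m ^+ 2 + c ^+ 2.
Proof. by move=> /andP[a0 am] c0; nra. Qed.

Let Ex (xs : n.-tuple nat) x : RR := expR (n%:R * p x / 4 - cnt xs x / 2).

(** A majorant valid for every sample of positive weight. The last sum over observations pays for
    samples reaching K and is nonnegative on the others, so no conditioning is required. *)
Let bnd (xs : n.-tuple nat) : RR :=
  \sum_(x < K) (16 / n%:R ^+ 2 / p x
      * (x.+1%:R * cnt xs x.+1 - b x * cnt xs x) ^+ 2
    + (5 * M ^+ 2 * p x * Ex xs x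
       + 8 * M / n%:R * x.+1%:R * (cnt xs x.+1 * Ex xs x)))
  + (M ^+ 2 * q + tb
     + \sum_(i < n) ((tnth xs i)%:R ^+ 2 * (K <= tnth xs i)%:R
                     + m2 * (K <= tnth xs i)%:R)).

Let cnt_ge0 (xs : n.-tuple nat) x : 0 <= cnt xs x :> RR.
Proof. by apply: sumr_ge0 => i _; rewrite ler0n. Qed.

Let q_ge0 : 0 <= q.
Proof.
by rewrite -lee_fin -qE; apply: esum_ge0 => x _; rewrite lee_fin mulr_ge0 ?ler0n.
Qed.

Let tb_ge0 : 0 <= tb.
Proof.
rewrite -lee_fin -tbE; apply: esum_ge0 => x _.
by rewrite lee_fin !mulr_ge0 ?ler0n ?sqr_ge0.
Qed.

Let m2_ge0 : 0 <= m2.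
Proof.
rewrite -lee_fin -m2E; apply: esum_ge0 => x _.
by rewrite lee_fin !mulr_ge0 ?ler0n ?sqr_ge0.
Qed.

Let Ex_ge0 xs x : 0 <= Ex xs x. Proof. exact: expR_ge0. Qed.

Let head_ge0 xs x : 0 <= 16 / n%:R ^+ 2 / p x
      * (x.+1%:R * cnt xs x.+1 - b x * cnt xs x) ^+ 2
    + (5 * M ^+ 2 * p x * Ex xs x
       + 8 * M / n%:R * x.+1%:R * (cnt xs x.+1 * Ex xs x)).
Proof.
have i0 : 0 <= (n%:R)^-1 :> RR by rewrite invr_ge0 ltW.
apply: addr_ge0; first apply: mulr_ge0 (sqr_ge0 _).
  by do ?apply: mulr_ge0 => //; rewrite invr_ge0 ?sqr_ge0.
by apply: addr_ge0; do ?apply: mulr_ge0.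
Qed.

(* On the event that some observation reaches [K], [f] is bounded by the sample
   maximum, which then reaches [K] as well. *)
Lemma loss_le_far (xs : n.-tuple nat) (f : nat -> RR) (i : 'I_n) :
  is_erm xs f -> (K <= tnth xs i)%N ->
  (\esum_(x in [set: nat]) (p x * (f x - b x) ^+ 2)%:E
   <= (\sum_(j < n) ((tnth xs j)%:R ^+ 2 * (K <= tnth xs j)%:R
                     + m2 * (K <= tnth xs j)%:R))%:E)%E.
Proof.
move=> ferm Ki.
have card_n : (0 < #|'I_n|)%N by rewrite card_ord.
have [j0 j0max] := bigop.eq_bigmax (fun j => tnth xs j) card_n.
have jm j : (tnth xs j <= tnth xs j0)%N.
  by rewrite -j0max; apply: (@leq_bigmax _ (fun j => tnth xs j)).
have fm := erm_le_max ferm jm.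
have [[f0 _] _ _ _] := ferm.
have Kj0 : (K <= tnth xs j0)%N by apply: leq_trans Ki (jm i).
apply: (@le_trans _ _ ((tnth xs j0)%:R ^+ 2 + m2)%:E).
  apply: (@le_trans _ _ (\esum_(x in [set: nat])
    (((tnth xs j0)%:R ^+ 2)%:E * (p x)%:E + (p x * b x ^+ 2)%:E))%E).
    apply: le_esum => x _; rewrite -EFinM -EFinD lee_fin.
    rewrite [leRHS](_ : _ = p x * ((tnth xs j0)%:R ^+ 2 + b x ^+ 2)); last by ring.
    rewrite ler_wpM2l//.
    by apply: sqr_le_of_ge0; rewrite ?f0 ?fm.
  rewrite esumD.
  - rewrite esumZl ?sqr_ge0//.
    by rewrite p_sum1 m2E mule1 -EFinD.
  - by move=> x _; rewrite -EFinM lee_fin mulr_ge0 ?sqr_ge0.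
  - by move=> x _; rewrite lee_fin mulr_ge0 ?sqr_ge0.
rewrite lee_fin (bigD1 j0)//= Kj0 !mulr1 lerDl sumr_ge0// => j _.
by rewrite addr_ge0// mulr_ge0// ?ler0n// sqr_ge0.
Qed.

(** Below K, summing [pointwise_offset] makes the offsets add up to the basic inequality, hence to
    something nonpositive. From K on, 0 <= f <= M gives (f - b)^2 <= M^2 + b^2, whence [q] and
    [tb]. *)
Lemma loss_le_near (xs : n.-tuple nat) (f : nat -> RR) :
  is_erm xs f -> 0 < wt (p := p) xs -> (forall i, (tnth xs i < K)%N) ->
  (\esum_(x in [set: nat]) (p x * (f x - b x) ^+ 2)%:E
   <= (\sum_(x < K) (16 / n%:R ^+ 2 / p x
      * (x.+1%:R * cnt xs x.+1 - b x * cnt xs x) ^+ 2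
    + (5 * M ^+ 2 * p x * Ex xs x
       + 8 * M / n%:R * x.+1%:R * (cnt xs x.+1 * Ex xs x)))
      + (M ^+ 2 * q + tb))%:E)%E.
Proof.
move=> ferm wpos xK.
have K0 : (0 < K)%N by apply: leq_trans (xK (Ordinal n_gt0)).
have xm i : (tnth xs i <= K.-1)%N by rewrite -ltnS prednK.
have [[f0 _] _ _ _] := ferm.
have fM x : f x <= M.
  by apply: le_trans (erm_le_max ferm xm x) (K_le _); rewrite prednK.
(* Positive weight rules out observations where p vanishes; with [pS], p(x) = 0 also forces N(x+1) =
   0, as the degenerate case of [pointwise_offset] demands. *)
have cnt0 x : p x = 0 -> cnt xs x = 0 :> RR.
  move=> px; apply: big1 => i _; case: eqP => // xi.
  by move: wpos; rewrite /wt (bigD1 i)//= xi px mul0r ltxx.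
have D0 x : 0 <= p x * (f x - b x) ^+ 2 by rewrite mulr_ge0 ?sqr_ge0.
apply: (@le_trans _ _ (\esum_(x in [set: nat])
   ((if (x < K)%N then p x * (f x - b x) ^+ 2 else 0)%:E
    + ((M ^+ 2)%:E * (p x * (K <= x)%:R)%:E
       + (p x * b x ^+ 2 * (K <= x)%:R)%:E)))%E).
  apply: le_esum => x _; rewrite -EFinM -!EFinD lee_fin.
  case: ltnP => _ /=.
    by rewrite !mulr0 !addr0.
  rewrite add0r !mulr1 mulrC [leRHS](_ : _ = (M ^+ 2 + b x ^+ 2) * p x); last by ring.
  by rewrite ler_wpM2r// sqr_le_of_ge0 ?f0 ?fM.
have q0 x : 0 <= p x * (K <= x)%:R by rewrite mulr_ge0 ?ler0n.
have t0 x : 0 <= p x * b x ^+ 2 * (K <= x)%:R.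
  by rewrite !mulr_ge0 ?ler0n ?sqr_ge0.
rewrite esumD; last 2 first.
- by move=> x _; rewrite lee_fin; case: ifP.
- by move=> x _; rewrite -EFinM -EFinD lee_fin addr_ge0// mulr_ge0// sqr_ge0.
rewrite esum_lt// esumD; last 2 first.
- by move=> x _; rewrite -EFinM lee_fin mulr_ge0// sqr_ge0.
- by move=> x _; rewrite lee_fin.
rewrite esumZl ?sqr_ge0//.
rewrite qE tbE -EFinM -!EFinD lee_fin lerD2r.
have basic := erm_basic_ineq ferm bF xK.
have n4 : 0 <= 4 / n%:R :> RR by rewrite divr_ge0// ltW.
have neg : \sum_(x < K) 4 / n%:R * (cnt xs x * (f x - b x) ^+ 2
    - 2 * (x.+1%:R * cnt xs x.+1 - cnt xs x * b x) * (f x - b x)) <= 0.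
  by rewrite -mulr_sumr mulr_ge0_le0.
rewrite -[leRHS]add0r -lerBlDr; apply: le_trans neg.
rewrite lerBlDr -big_split /=; apply: ler_sum => x _.
have xltK := ltn_ord x.
have := @pointwise_offset _ (p x) (cnt xs x) (x.+1%:R * cnt xs x.+1) (b x)
  (f x - b x) M n%:R (Ex xs x) n_pos (p_ge0 x) (cnt_ge0 xs x).
move=> /(_ (mulr_ge0 (ler0n _ _) (cnt_ge0 xs x.+1))).
rewrite b_ge0 b_le// => /(_ isT) /= pw; apply: le_trans (pw _ _ _ _) _ => //.
- by rewrite ler_norml; have := fM x; have := f0 x; have := b_ge0 x;
    have := b_le xltK; lra.
- move=> px; have px1 : p x.+1 = 0.
    by apply/eqP; have /eqP := pS x; rewrite px mulr0 mulf_eq0 pnatr_eq0.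
  by rewrite !cnt0// mulr0.
- move=> small; rewrite -[leLHS]expR0 ler_expR; lra.
- rewrite le_eqVlt; apply/orP; left; apply/eqP; congr (_ + (_ + _)); ring.
Qed.

(** The recursion [pS] turns both p(x+1) terms into multiples of b(x) p(x), which cancels the
    division by p(x). The factor 21 is 5 + 16, the 16 arising from 16 M b(x) <= 16 M^2. *)
Let expect_head x : (x < K)%N ->
  (expect (p := p) (fun xs : n.-tuple nat => (16 / n%:R ^+ 2 / p x
      * (x.+1%:R * cnt xs x.+1 - b x * cnt xs x) ^+ 2
    + (5 * M ^+ 2 * p x * Ex xs x
       + 8 * M / n%:R * x.+1%:R * (cnt xs x.+1 * Ex xs x)))%R)
  <= (16 / n%:R * (b x * (x.+1%:R + b x))
      + 21 * M ^+ 2 * (p x * expR (- (n%:R * p x / 12))))%:E)%E.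
Proof.
move=> xK.
have i0 : 0 <= (n%:R)^-1 :> RR by rewrite invr_ge0 ltW.
have c1 : 0 <= 16 / n%:R ^+ 2 / p x.
  by do ?apply: mulr_ge0 => //; rewrite invr_ge0 ?sqr_ge0.
have c2 : 0 <= 5 * M ^+ 2 * p x by do ?apply: mulr_ge0.
have c3 : 0 <= 8 * M / n%:R * x.+1%:R by do ?apply: mulr_ge0.
have s1 (xs : n.-tuple nat) : 0 <= cnt xs x.+1 * Ex xs x by rewrite mulr_ge0.
have s2 (xs : n.-tuple nat) :
    0 <= (x.+1%:R * cnt xs x.+1 - b x * cnt xs x) ^+ 2 by exact: sqr_ge0.
rewrite expectD//; last 2 first.
- by move=> xs; rewrite mulr_ge0.
- by move=> xs; rewrite addr_ge0// mulr_ge0.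
rewrite expectD//; last 2 first.
- by move=> xs; rewrite mulr_ge0.
- by move=> xs; rewrite mulr_ge0.
rewrite !expectZ// EFinD; apply: leeD.
  have xx : x.+1 != x by rewrite neq_ltn ltnSn orbT.
  rewrite (expect_cnt_var p_ge0 p_sum1 n xx (ler0n _ _) (b_ge0 x) (pS x)).
  rewrite -EFinM lee_fin.
  (* At p(x) = 0 the inverse is 0, so the left side vanishes. *)
  have [px|px] := eqVneq (p x) 0.
    rewrite px invr0 mulr0 mul0r; do ?apply: mulr_ge0 => //.
    by rewrite addr_ge0.
  have -> : x.+1%:R ^+ 2 * p x.+1 = x.+1%:R * (b x * p x) by rewrite -pS; ring.
  rewrite le_eqVlt; apply/orP; left; apply/eqP.
  by field; rewrite px gt_eqF.
apply: (@le_trans _ _ ((5 * M ^+ 2 * p x * expR (- (n%:R * p x / 12)))%:E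
  + (8 * M / n%:R * x.+1%:R
     * (2 * n%:R * p x.+1 * expR (- (n%:R * p x / 12))))%:E)%E).
  apply: leeD; rewrite [leRHS]EFinM; apply: lee_pmul => //; rewrite ?lee_fin//.
  - exact: expect_ge0.
  - exact: expect_expcnt.
  - exact: expect_ge0.
  - by apply: expect_cnt_expcnt => //; rewrite neq_ltn ltnSn.
rewrite -EFinD lee_fin.
rewrite (_ : 8 * M / n%:R * x.+1%:R * (2 * n%:R * p x.+1 * expR (- (n%:R * p x / 12)))
  = 16 * M * b x * (p x * expR (- (n%:R * p x / 12)))); last first.
  rewrite [RHS](_ : _ = 16 * M * (b x * p x) * expR (- (n%:R * p x / 12))); last by ring.
  by rewrite -pS; field; rewrite gt_eqF.
have pe : 0 <= p x * expR (- (n%:R * p x / 12)) by rewrite mulr_ge0// expR_ge0.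
have MbM : M * b x <= M ^+ 2 by rewrite expr2 ler_wpM2l// b_le.
have := ler_wpM2r pe MbM; lra.
Qed.

Lemma expected_loss_le (est : n.-tuple nat -> nat -> RR) :
  (forall xs, is_erm xs (est xs)) ->
  (\esum_(xs in [set: n.-tuple nat]) ((wt (p := p) xs)%:E
     * \esum_(x in [set: nat]) (p x * (est xs x - b x) ^+ 2)%:E)
   <= (\sum_(x < K) (16 / n%:R * (b x * (x.+1%:R + b x))
        + 21 * M ^+ 2 * (p x * expR (- (n%:R * p x / 12))))
      + (M ^+ 2 * q + tb + n%:R * (tx + m2 * q)))%:E)%E.
Proof.
move=> erm.
have far0 (xs : n.-tuple nat) (i : 'I_n) : 0 <= (tnth xs i)%:R ^+ 2 * (K <= tnth xs i)%:R
    + m2 * (K <= tnth xs i)%:R :> RR.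
  by rewrite addr_ge0// mulr_ge0// ?ler0n// sqr_ge0.
have rem0 : 0 <= M ^+ 2 * q + tb by rewrite addr_ge0// mulr_ge0// sqr_ge0.
apply: (@le_trans _ _ (expect (p := p) bnd)).
  apply: le_esum => xs _; rewrite EFinM.
  (* Samples of zero weight contribute 0 even if their loss is infinite. *)
  have := wt_ge0 p_ge0 xs; rewrite [0 <= _]le_eqVlt => /orP[/eqP <-|wpos].
    by rewrite !mul0e.
  rewrite lee_pmul2l ?lte_fin//.
  have [/forallP xK|/forallPn[i]] := boolP [forall i, (tnth xs i < K)%N].
    apply: le_trans (loss_le_near (erm xs) wpos xK) _.
    by rewrite lee_fin /bnd lerD2l lerDl sumr_ge0.
  rewrite -leqNgt => Ki.
  apply: le_trans (loss_le_far (erm xs) Ki) _.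
  by rewrite lee_fin /bnd addrA lerDr addr_ge0// sumr_ge0.
rewrite /bnd expectD//; last 2 first.
- by move=> xs; apply: sumr_ge0 => x _; exact: head_ge0.
- by move=> xs; rewrite addr_ge0// sumr_ge0.
rewrite EFinD; apply: leeD.
  rewrite expect_sum//.
  rewrite -sumEFin; apply: lee_sum => x _; exact: expect_head.
rewrite expectD//; last by move=> xs; rewrite sumr_ge0.
rewrite EFinD; apply: leeD.
  rewrite [X in (X <= _)%E](_ : _ = expect (p := p) (fun _ : n.-tuple nat => (M ^+ 2 * q + tb) * 1)); last first.
    by congr expect; apply/funext => xs; rewrite mulr1.
  by rewrite expectZ// expect1// mule1.
rewrite expect_sum//.
rewrite (eq_bigr (fun=> (tx + m2 * q)%:E)); last first.
  move=> i _.
  rewrite (@expect_coord RR p p_ge0 p_sum1 n i (fun x => x%:R ^+ 2 * (K <= x)%:R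
    + m2 * (K <= x)%:R) (tx + m2 * q))//.
    by move=> x; rewrite addr_ge0// mulr_ge0// ?ler0n// sqr_ge0.
  rewrite EFinD EFinM -txE -qE -esumZl//; last first.
    by move=> x; rewrite lee_fin mulr_ge0// ler0n.
  rewrite -esumD; last 2 first.
  - by move=> x _; rewrite lee_fin !mulr_ge0// ?ler0n// sqr_ge0.
  - by move=> x _; rewrite -EFinM lee_fin !mulr_ge0// ler0n.
  by apply: eq_esum => x _; rewrite -EFinM -EFinD; congr EFin; ring.
by rewrite sumEFin sumr_const card_ord mulr_natl.
Qed.

End Core.

(** * Truncation *)

(** Produces the real values that the equations [qE], [txE], [tbE] and [m2E] call for. *)
Lemma esum_fin (R : realType) (T : choiceType) (F : T -> R) (r : R) :
  (forall x, 0 <= F x) -> (\esum_(x in [set: T]) (F x)%:E <= r%:E)%E ->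
  exists2 q : R, (\esum_(x in [set: T]) (F x)%:E)%E = q%:E & 0 <= q <= r.
Proof.
move=> F0 Fr.
have S0 : (0 <= \esum_(x in [set: T]) (F x)%:E)%E.
  by apply: esum_ge0 => x _; rewrite lee_fin.
have fin : (\esum_(x in [set: T]) (F x)%:E)%E \is a fin_num.
  by rewrite ge0_fin_numE// (le_lt_trans Fr)// ltry.
exists (fine (\esum_(x in [set: T]) (F x)%:E)); first by rewrite fineK.
by rewrite -!lee_fin fineK// S0 Fr.
Qed.

Lemma le_esumZ (R : realType) (T : choiceType) (F G : T -> R) (c r : R) :
  0 <= c -> (forall x, 0 <= G x) -> (forall x, F x <= c * G x) ->
  (\esum_(x in [set: T]) (G x)%:E <= r%:E)%E ->
  (\esum_(x in [set: T]) (F x)%:E <= (c * r)%:E)%E.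
Proof.
move=> c0 G0 FG Gr; apply: (@le_trans _ _ (c%:E * \esum_(x in [set: T]) (G x)%:E)%E).
  rewrite -esumZl//.
  by apply: le_esum => x _; rewrite -EFinM lee_fin.
rewrite EFinM; apply: lee_pmul => //.
by apply: esum_ge0 => x _; rewrite lee_fin.
Qed.

Lemma le_esumZ2 (R : realType) (T : choiceType) (F G H : T -> R) (c d r t : R) :
  0 <= c -> 0 <= d -> (forall x, 0 <= G x) -> (forall x, 0 <= H x) ->
  (forall x, F x <= c * G x + d * H x) ->
  (\esum_(x in [set: T]) (G x)%:E <= r%:E)%E ->
  (\esum_(x in [set: T]) (H x)%:E <= t%:E)%E ->
  (\esum_(x in [set: T]) (F x)%:E <= (c * r + d * t)%:E)%E.
Proof.
move=> c0 d0 G0 H0 FGH Gr Ht.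
apply: (@le_trans _ _ (\esum_(x in [set: T]) ((c * G x)%:E + (d * H x)%:E))%E).
  by apply: le_esum => x _; rewrite -EFinD lee_fin.
rewrite esumD; last 2 first.
- by move=> x _; rewrite lee_fin mulr_ge0.
- by move=> x _; rewrite lee_fin mulr_ge0.
by rewrite EFinD; apply: leeD; [apply: le_esumZ Gr|apply: le_esumZ Ht].
Qed.

Lemma expR_ge_sqr (R : realType) (y : R) : 0 <= y -> y ^+ 2 <= 2 * expR y.
Proof. by move=> y0; have := expR_ge1Dxn 1 y0; rewrite !factS fact0 /=; lra. Qed.

Lemma expR_ge_pow4 (R : realType) (y : R) : 0 <= y -> y ^+ 4 <= 24 * expR y.
Proof. by move=> y0; have := expR_ge1Dxn 3 y0; rewrite !factS fact0 /=; lra. Qed.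

Lemma mul_expRN_le1 (R : realType) (y : R) : 0 <= y -> y * expR (- y) <= 1.
Proof.
move=> y0; have := expR_ge1Dx y; have := expRxMexpNx_1 y; have := expR_gt0 (- y).
nra.
Qed.

Lemma ln3_gt1 (R : realType) : 1 < ln 3 :> R.
Proof.
(* Six is the least number of factors for which 1 + x <= exp x gives e < 3: (5/6)^6 > 1/3, whereas
   (4/5)^5 < 1/3. *)
have e6 : (5 / 6) ^+ 6 <= expR (- (1 / 6)) ^+ 6 :> R.
  rewrite lerXn2r// ?nnegrE ?expR_ge0 ?divr_ge0//.
  by apply: le_trans (expR_ge1Dx _); lra.
rewrite -expRM_natl (_ : 6%:R * - (1 / 6) = - 1) in e6; last by lra.
have e1 := expRxMexpNx_1 (1 : R).
have e3 : expR 1 < 3 :> R.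
  have : 1 / 3 < expR (- 1) :> R by apply: lt_le_trans e6; lra.
  have := expR_gt0 (1 : R); nra.
by rewrite -ltr_expR lnK// posrE.
Qed.

(** With q of order n^-4, the two truncated second moments are of order n^-2, so even the terms
    multiplied by n are O(1/n). *)
Lemma remainder_le (R : realType) (n s M Q K0 c1 c2 c3 q tx tb m2 : R) :
  1 <= n -> 0 <= Q -> 0 <= K0 -> 0 <= c1 -> 0 <= c2 -> 0 <= c3 -> 0 <= q <= Q / n ^+ 4 ->
  tx <= c1 * s ^+ 2 / n ^+ 2 * K0 + n ^+ 2 * s ^+ 2 * (Q / n ^+ 4) ->
  tb <= c2 * s ^+ 2 / n ^+ 2 * K0 + n ^+ 2 * s ^+ 2 * (Q / n ^+ 4) ->
  0 <= m2 <= c3 * s ^+ 2 * K0 ->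
  M ^+ 2 * q + tb + n * (tx + m2 * q)
  <= (M ^+ 2 * Q + ((c1 + c2) * K0 + 2 * Q + c3 * K0 * Q) * s ^+ 2) / n.
Proof.
move=> n1 Q0 K00 c10 c20 c30 /andP[q0 qQ] txK tbK /andP[m20 m2K].
have n_pos : 0 < n by lra.
have nu0 : 0 <= n^-1 :> R by rewrite invr_ge0 ltW.
have nu1 : n^-1 <= 1 :> R by rewrite invf_le1.
have nuX k : n^-1 ^+ k.+1 <= n^-1 :> R.
  by rewrite exprS ler_piMr// exprn_ile1.
have s2 : 0 <= s ^+ 2 by rewrite sqr_ge0.
have M2 : 0 <= M ^+ 2 by rewrite sqr_ge0.
have nV : n * n^-1 = 1 :> R by rewrite mulfV// gt_eqF.
have e4 : n ^+ 2 * s ^+ 2 * (Q / n ^+ 4) = Q * s ^+ 2 * n^-1 ^+ 2 :> R.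
  by field; rewrite gt_eqF.
move: tbK txK qQ; rewrite e4 -!exprVn => tbK txK qQ.
have t1 : M ^+ 2 * q <= M ^+ 2 * Q * n^-1.
  rewrite -mulrA ler_wpM2l//; apply: le_trans qQ _; exact: ler_wpM2l.
have t2 : tb <= (c2 * K0 + Q) * s ^+ 2 * n^-1.
  apply: (@le_trans _ _ ((c2 * K0 + Q) * s ^+ 2 * n^-1 ^+ 2)); first by lra.
  by apply: ler_wpM2l; rewrite ?nuX// mulr_ge0// addr_ge0// mulr_ge0.
have t3 : n * tx <= (c1 * K0 + Q) * s ^+ 2 * n^-1.
  apply: (@le_trans _ _ (n * ((c1 * K0 + Q) * s ^+ 2 * n^-1 ^+ 2))).
    by apply: ler_wpM2l; [exact: ltW|lra].
  by rewrite le_eqVlt; apply/orP; left; apply/eqP; field; rewrite gt_eqF.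
have t4 : n * (m2 * q) <= c3 * K0 * Q * s ^+ 2 * n^-1.
  apply: (@le_trans _ _ (n * (c3 * s ^+ 2 * K0 * (Q * n^-1 ^+ 4)))).
    by apply: ler_wpM2l; [exact: ltW|exact: ler_pM].
  rewrite [leLHS](_ : _ = c3 * K0 * Q * s ^+ 2 * n^-1 ^+ 3); last first.
    by field; rewrite gt_eqF.
  by apply: ler_wpM2l; rewrite ?nuX// mulr_ge0// mulr_ge0// mulr_ge0.
rewrite mulrDr; lra.
Qed.

Section SequenceBound.
Variables (p b : nat -> RR) (n : nat) (M s K0 Q : RR).
Hypothesis p_ge0 : forall x, 0 <= p x.
Hypothesis p_sum1 : (\esum_(x in [set: nat]) (p x)%:E = 1)%E.
Hypothesis bF : inF b.
Hypothesis pS : forall x, x.+1%:R * p x.+1 = b x * p x.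
Hypothesis n_gt0 : (0 < n)%N.
Hypothesis M_ge0 : 0 <= M.
Hypothesis s_gt0 : 0 < s.
Hypothesis HX :
  (\esum_(x in [set: nat]) (p x * expR (x%:R / (4 * s)))%:E <= K0%:E)%E.
Hypothesis Hb :
  (\esum_(x in [set: nat]) (p x * expR (b x / (2 * s)))%:E <= K0%:E)%E.
Hypothesis HQ :
  (\esum_(x in [set: nat]) (p x * ((M < x%:R) || (M < b x))%:R)%:E
   <= (Q / n%:R ^+ 4)%:E)%E.

(** As b is nondecreasing, the set where x or b(x) exceeds M is closed upwards, and K is its least
    element; it is nonempty because x itself passes M. *)
Lemma threshold_ex : exists K : nat,
  (forall x, (x < K)%N -> x%:R <= M /\ b x <= M) /\
  (forall x, (K <= x)%N -> (M < x%:R) || (M < b x)).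
Proof.
have [_ bmon] := bF.
have ex : exists x : nat, (M < x%:R) || (M < b x).
  exists (Num.trunc M).+1; apply/orP; left.
  by have /andP[] := truncn_itv M_ge0.
exists (ex_minn ex); case: ex_minnP => K PK Kmin; split=> x.
  move=> xK; have : ~~ ((M < x%:R) || (M < b x)).
    by apply/negP => /Kmin; rewrite leqNgt xK.
  by rewrite negb_or -!leNgt => /andP[].
move=> Kx; case/orP: PK => [MK|MK]; apply/orP; [left|right].
  by apply: lt_le_trans MK _; rewrite ler_nat.
by apply: lt_le_trans MK (bmon _ _ Kx).
Qed.

Lemma sequence_bound (est : n.-tuple nat -> nat -> RR) :
  (forall xs, is_erm xs (est xs)) ->
  exists2 K : nat, (forall x, (x < K)%N -> x%:R <= M /\ b x <= M) &
  (\esum_(xs in [set: n.-tuple nat]) ((wt (p := p) xs)%:E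
     * \esum_(x in [set: nat]) (p x * (est xs x - b x) ^+ 2)%:E)
   <= (\sum_(x < K) (16 / n%:R * (b x * (x.+1%:R + b x))
        + 21 * M ^+ 2 * (p x * expR (- (n%:R * p x / 12))))
      + (M ^+ 2 * Q + (6528 * K0 + 2 * Q + 8 * K0 * Q) * s ^+ 2) / n%:R)%:E)%E.
Proof.
move=> erm; have [K [KM MK]] := threshold_ex; exists K => //.
have [b0 _] := bF.
have n1 : 1 <= n%:R :> RR by rewrite ler1n.
have n_pos : 0 < n%:R :> RR by rewrite ltr0n.
have [||q qE /andP[q0 qQ]] := @esum_fin _ _ (fun x => p x * (K <= x)%:R) (Q / n%:R ^+ 4).
- by move=> x; rewrite mulr_ge0 ?ler0n.
- apply: le_trans HQ; apply: le_esum => x _; rewrite lee_fin ler_wpM2l//.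
  by rewrite ler_nat; case: (leqP K x) => [Kx|//]; rewrite MK.
have pX0 x : 0 <= p x * expR (x%:R / (4 * s)) by rewrite mulr_ge0 ?expR_ge0.
have pB0 x : 0 <= p x * expR (b x / (2 * s)) by rewrite mulr_ge0 ?expR_ge0.
have qx0 x : 0 <= p x * (K <= x)%:R by rewrite mulr_ge0 ?ler0n.
have s0 : 0 <= s by rewrite ltW.
(* The constants come from y^4 <= 24 exp y and y^2 <= 2 exp y after rescaling: 24 * 4^4 = 6144, then
   24 * 2^4 = 384 and 2 * 2^2 = 8. *)
have x4 x : x%:R ^+ 4 <= 6144 * s ^+ 4 * expR (x%:R / (4 * s)) :> RR.
  have y0 : 0 <= x%:R / (4 * s) by rewrite divr_ge0 ?ler0n// mulr_ge0.
  have := ler_wpM2l (exprn_ge0 4 (mulr_ge0 (ler0n _ 4) s0)) (expR_ge_pow4 y0).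
  rewrite -exprMn mulrC divfK ?mulf_neq0 ?gt_eqF//.
  by move=> /le_trans; apply; rewrite le_eqVlt; apply/orP; left; apply/eqP; ring.
have b4 x : b x ^+ 4 <= 384 * s ^+ 4 * expR (b x / (2 * s)) :> RR.
  have y0 : 0 <= b x / (2 * s) by rewrite divr_ge0// mulr_ge0.
  have := ler_wpM2l (exprn_ge0 4 (mulr_ge0 (ler0n _ 2) s0)) (expR_ge_pow4 y0).
  rewrite -exprMn mulrC divfK ?mulf_neq0 ?gt_eqF//.
  by move=> /le_trans; apply; rewrite le_eqVlt; apply/orP; left; apply/eqP; ring.
have b2 x : b x ^+ 2 <= 8 * s ^+ 2 * expR (b x / (2 * s)) :> RR.
  have y0 : 0 <= b x / (2 * s) by rewrite divr_ge0// mulr_ge0.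
  have := ler_wpM2l (exprn_ge0 2 (mulr_ge0 (ler0n _ 2) s0)) (expR_ge_sqr y0).
  rewrite -exprMn mulrC divfK ?mulf_neq0 ?gt_eqF//.
  by move=> /le_trans; apply; rewrite le_eqVlt; apply/orP; left; apply/eqP; ring.
have [||m2 m2E /andP[m20 m2K]] := @esum_fin _ _ (fun x => p x * b x ^+ 2) (8 * s ^+ 2 * K0).
- by move=> x; rewrite mulr_ge0 ?sqr_ge0.
- apply: le_esumZ Hb => //; first by rewrite mulr_ge0// sqr_ge0.
  by move=> x; rewrite [leRHS]mulrCA ler_wpM2l.
(* [a^2 <= a^4 / t^2 + t^2] with [t = n s] *)
have trunc2 (a c e : RR) x : 0 <= c -> 0 <= e -> a ^+ 4 <= c * s ^+ 4 * e ->
    p x * (a ^+ 2 * (K <= x)%:R) <=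
    c * s ^+ 2 / n%:R ^+ 2 * (p x * e) + n%:R ^+ 2 * s ^+ 2 * (p x * (K <= x)%:R).
  move=> c0 e0 a4.
  have t0 : 0 < n%:R * s by rewrite mulr_gt0.
  have ce : 0 <= c * s ^+ 2 / n%:R ^+ 2 * e.
    by rewrite mulr_ge0// divr_ge0 ?sqr_ge0// mulr_ge0// sqr_ge0.
  rewrite [leRHS](_ : _ = p x * (c * s ^+ 2 / n%:R ^+ 2 * e
    + (n%:R * s) ^+ 2 * (K <= x)%:R)); last by ring.
  rewrite ler_wpM2l//; case: leqP => _ /=; last by rewrite !mulr0 addr0.
  rewrite !mulr1.
  have -> : c * s ^+ 2 / n%:R ^+ 2 * e = c * s ^+ 4 * e / (n%:R * s) ^+ 2.
    by field; rewrite !gt_eqF.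
  apply: (@le_trans _ _ (a ^+ 4 / (n%:R * s) ^+ 2 + (n%:R * s) ^+ 2)); last first.
    by rewrite lerD2r ler_wpM2r// invr_ge0 sqr_ge0.
  rewrite -subr_ge0 (_ : _ - _ = (a ^+ 2 / (n%:R * s) - n%:R * s) ^+ 2 + a ^+ 2).
    by rewrite addr_ge0// sqr_ge0.
  by field; rewrite !gt_eqF.
have n4 : 0 <= n%:R ^+ 2 * s ^+ 2 :> RR by rewrite mulr_ge0 ?sqr_ge0.
have c0 (c : RR) : 0 <= c -> 0 <= c * s ^+ 2 / n%:R ^+ 2.
  by move=> c0; rewrite divr_ge0 ?sqr_ge0// mulr_ge0// sqr_ge0.
have qq : (\esum_(x in [set: nat]) (p x * (K <= x)%:R)%:E <= (Q / n%:R ^+ 4)%:E)%E.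
  by rewrite qE lee_fin.
have [||tx txE /andP[tx0 txK]] := @esum_fin _ _
   (fun x => p x * (x%:R ^+ 2 * (K <= x)%:R))
   (6144 * s ^+ 2 / n%:R ^+ 2 * K0 + n%:R ^+ 2 * s ^+ 2 * (Q / n%:R ^+ 4)).
- by move=> x; rewrite !mulr_ge0 ?sqr_ge0 ?ler0n.
- apply: (@le_esumZ2 _ _ _ _ _ (6144 * s ^+ 2 / n%:R ^+ 2) (n%:R ^+ 2 * s ^+ 2)
    K0 (Q / n%:R ^+ 4) (c0 _ (ler0n _ _)) n4 pX0 qx0 _ HX qq).
  by move=> x; exact: trunc2 (ler0n _ _) (expR_ge0 _) (x4 x).
have [||tb tbE /andP[tb0 tbK]] := @esum_fin _ _
   (fun x => p x * b x ^+ 2 * (K <= x)%:R)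
   (384 * s ^+ 2 / n%:R ^+ 2 * K0 + n%:R ^+ 2 * s ^+ 2 * (Q / n%:R ^+ 4)).
- by move=> x; rewrite !mulr_ge0 ?sqr_ge0 ?ler0n.
- apply: (@le_esumZ2 _ _ _ _ _ (384 * s ^+ 2 / n%:R ^+ 2) (n%:R ^+ 2 * s ^+ 2)
    K0 (Q / n%:R ^+ 4) (c0 _ (ler0n _ _)) n4 pB0 qx0 _ Hb qq).
  by move=> x; rewrite -mulrA; exact: trunc2 (ler0n _ _) (expR_ge0 _) (b4 x).
apply: le_trans (expected_loss_le p_ge0 p_sum1 bF pS n_gt0 M_ge0 _ _ qE txE tbE m2E erm) _.
- by move=> x /KM[].
- by move=> x /KM[].
rewrite lee_fin lerD2l.
have Q0 : 0 <= Q.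
  by have := le_trans q0 qQ; rewrite pmulr_lge0// invr_gt0 exprn_gt0.
have K00 : 0 <= K0.
  by have := le_trans m20 m2K; rewrite pmulr_rge0// mulr_gt0// exprn_gt0.
have -> : 6528 = 6144 + 384 :> RR by rewrite -natrD.
have qI : 0 <= q <= Q / n%:R ^+ 4 by rewrite q0.
have m2I : 0 <= m2 <= 8 * s ^+ 2 * K0 by rewrite m20.
exact: (@remainder_le _ n%:R s M Q K0 6144 384 8 q tx tb m2 n1 Q0 K00 (ler0n _ _)
  (ler0n _ _) (ler0n _ _) qI txK tbK m2I).
Qed.

End SequenceBound.

(** * The two rates *)

Lemma ln_nat_gt1 (n : nat) : (3 <= n)%N -> 1 < ln (n%:R : RR).
Proof.
move=> n3; apply: lt_le_trans (ln3_gt1 _) _.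
by rewrite ler_ln ?posrE ?ltr0n ?ler_nat// (leq_trans _ n3).
Qed.

Lemma expRN_ln_nat (n k : nat) : (0 < n)%N ->
  expR (- (k%:R * ln n%:R)) = (n%:R ^+ k)^-1 :> RR.
Proof. by move=> n0; rewrite expRN expRM_natl lnK// posrE ltr0n. Qed.

Lemma card_le_threshold (K : nat) (M : RR) : 1 <= M ->
  (forall x, (x < K)%N -> x%:R <= M) -> K%:R <= 2 * M.
Proof.
case: K => [|K] M1 KM; first by lra.
by have := KM K (ltnSn K); rewrite -natr1; lra.
Qed.

(** The coefficient of s^2 / n in [sequence_bound], with 6528 = 6144 + 384. *)
Definition tail_const (K0 Q : RR) : RR := 6528 * K0 + 2 * Q + 8 * K0 * Q.

Lemma tail_const_ge0 K0 Q : 0 <= K0 -> 0 <= Q -> 0 <= tail_const K0 Q.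
Proof.
by move=> K00 Q0; apply: addr_ge0; first apply: addr_ge0;
  rewrite mulr_ge0 ?ler0n// mulr_ge0 ?ler0n.
Qed.

Section FinalBounds.
Variables (p b : nat -> RR) (n : nat) (s K0 : RR).
Hypothesis p_ge0 : forall x, 0 <= p x.
Hypothesis p_sum1 : (\esum_(x in [set: nat]) (p x)%:E = 1)%E.
Hypothesis bF : inF b.
Hypothesis pS : forall x, x.+1%:R * p x.+1 = b x * p x.
Hypothesis n_ge3 : (3 <= n)%N.
Hypothesis s_ge1 : 1 <= s.
Hypothesis K0_ge0 : 0 <= K0.
Hypothesis HX :
  (\esum_(x in [set: nat]) (p x * expR (x%:R / (4 * s)))%:E <= K0%:E)%E.
Hypothesis Hb :
  (\esum_(x in [set: nat]) (p x * expR (b x / (2 * s)))%:E <= K0%:E)%E.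
Variable est : n.-tuple nat -> nat -> RR.
Hypothesis est_erm : forall xs, is_erm xs (est xs).

Let n_gt0 : (0 < n)%N. Proof. exact: leq_trans n_ge3. Qed.
Let n_pos : 0 < n%:R :> RR. Proof. by rewrite ltr0n. Qed.
Let b_ge0 x : 0 <= b x. Proof. by case: bF. Qed.

Let expterm_le x : p x * expR (- (n%:R * p x / 12)) <= 12 / n%:R.
Proof.
have y0 : 0 <= n%:R * p x / 12 by rewrite divr_ge0// mulr_ge0// ltW.
rewrite ler_pdivlMr//; have := mul_expRN_le1 y0; lra.
Qed.

Lemma subexp_bound :
  (\esum_(xs in [set: n.-tuple nat]) ((wt (p := p) xs)%:E
     * \esum_(x in [set: nat]) (p x * (est xs x - b x) ^+ 2)%:E)
   <= (16 ^+ 3 * (2 * 300 + 2 * K0 + tail_const K0 (2 * K0))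
       * s ^+ 3 / n%:R * ln n%:R ^+ 3)%:E)%E.
Proof.
have L1 := ln_nat_gt1 n_ge3; set L := ln n%:R in L1 *.
(* Chosen so that exp(M / (4 s)) = n^4; the moment of b, taken at 1 / (2 s), would even give n^8.
   Hence Q = 2 [K0] below. *)
pose M := 16 * s * L.
have s1 := s_ge1; have K00 := K0_ge0; have s0 : 0 < s by lra.
have M1 : 1 <= M by rewrite /M; nra.
have sM : s <= M by rewrite /M; nra.
have M0 : 0 <= M by lra.
have HQ : (\esum_(x in [set: nat]) (p x * ((M < x%:R) || (M < b x))%:R)%:E
   <= (2 * K0 / n%:R ^+ 4)%:E)%E.
  rewrite (_ : 2 * K0 / n%:R ^+ 4 = (n%:R ^+ 4)^-1 * K0 + (n%:R ^+ 4)^-1 * K0); last by ring.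
  have i0 : 0 <= (n%:R ^+ 4)^-1 :> RR by rewrite invr_ge0 exprn_ge0// ltW.
  apply: le_esumZ2 HX Hb => //.
  - by move=> x; rewrite mulr_ge0 ?expR_ge0.
  - by move=> x; rewrite mulr_ge0 ?expR_ge0.
  move=> x; rewrite [leRHS](_ : _ = p x * ((n%:R ^+ 4)^-1 * expR (x%:R / (4 * s))
    + (n%:R ^+ 4)^-1 * expR (b x / (2 * s)))); last by ring.
  rewrite ler_wpM2l// -(expRN_ln_nat 4 n_gt0) -/L -!expRD.
  have e1 := expR_ge0 (- (4 * L) + x%:R / (4 * s)).
  have e2 := expR_ge0 (- (4 * L) + b x / (2 * s)).
  case: ltP => [Mx|_] /=.
    have : 1 <= expR (- (4 * L) + x%:R / (4 * s)).
      rewrite -[leLHS]expR0 ler_expR addrC subr_ge0 ler_pdivlMr ?mulr_gt0//.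
      by rewrite (_ : 4 * L * (4 * s) = M) ?ltW// /M; ring.
    lra.
  case: ltP => [Mb|_] /=; last by lra.
  have : 1 <= expR (- (4 * L) + b x / (2 * s)).
    rewrite -[leLHS]expR0 ler_expR addrC subr_ge0 ler_pdivlMr ?mulr_gt0//.
    by rewrite (_ : 4 * L * (2 * s) = M / 2); [lra|rewrite /M; field].
  lra.
have [K KM bnd] := sequence_bound p_ge0 p_sum1 bF pS n_gt0 M0 s0 HX Hb HQ est_erm.
apply: le_trans bnd _; rewrite lee_fin -/(tail_const _ _).
have T0 : 0 <= tail_const K0 (2 * K0) by apply: tail_const_ge0; rewrite ?mulr_ge0.
set T := tail_const _ _ in T0 *.
have nI : 0 < (n%:R)^-1 :> RR by rewrite invr_gt0.
apply: (@le_trans _ _ ((2 * 300 + 2 * K0 + T) * M ^+ 3 / n%:R)); last first.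
  by rewrite le_eqVlt; apply/orP; left; apply/eqP; rewrite /M; field; rewrite gt_eqF.
rewrite [leRHS](_ : _ = 2 * 300 * M ^+ 3 / n%:R + (2 * K0 + T) * M ^+ 3 / n%:R); last by ring.
apply: lerD.
  (* Here 300 = 16 * 3 + 21 * 12: the variance term uses x + 1 + b(x) <= 3 M, the other one
     [expterm_le]. The K <= 2 M summands bring the third power of M. *)
  apply: (@le_trans _ _ (\sum_(x < K) (300 * M ^+ 2 / n%:R))).
    apply: ler_sum => x _; have [xM bM] := KM x (ltn_ord x).
    have e := expterm_le x; have b0 := b_ge0 x.
    have q3 : b x * (x.+1%:R + b x) <= M * (3 * M).
      apply: ler_pM => //; first by rewrite addr_ge0.
      by rewrite -natr1; lra.
    have M2 : 0 <= 21 * M ^+ 2 := mulr_ge0 (ler0n _ _) (sqr_ge0 M).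
    have := ler_wpM2l M2 e.
    have : 16 / n%:R * (b x * (x.+1%:R + b x)) <= 16 / n%:R * (M * (3 * M)).
      by rewrite ler_wpM2l// divr_ge0// ltW.
    lra.
  rewrite sumr_const card_ord -[_ *+ K]mulr_natl.
  have KM2 : K%:R <= 2 * M by apply: card_le_threshold => // x /KM[].
  rewrite [leRHS](_ : _ = 2 * M * (300 * M ^+ 2 / n%:R)); last by ring.
  exact: ler_wpM2r (divr_ge0 (mulr_ge0 (ler0n _ 300) (sqr_ge0 M)) (ltW n_pos)) _ _ KM2.
apply: ler_wpM2r; first exact: ltW.
have M23 : M ^+ 2 <= M ^+ 3 by rewrite [M ^+ 3]exprS ler_peMl// sqr_ge0.
have s2M : s ^+ 2 <= M ^+ 3.
  by apply: le_trans M23; rewrite lerXn2r ?nnegrE// ltW.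
have K20 : 0 <= 2 * K0 by rewrite mulr_ge0.
rewrite [leRHS](_ : _ = M ^+ 3 * (2 * K0) + T * M ^+ 3); last by ring.
by apply: lerD; [exact: ler_wpM2r|exact: ler_wpM2l].
Qed.

(* With [u x = n p(x) / 12], [u] halves at every step beyond [2 h], and then
   [u e^(-u) / 2 <= e^(-u') - e^(-u)] for the next value [u'], which telescopes. *)
Lemma sum_exp_decay h K : 1 <= h -> (forall x, b x <= h) ->
  \sum_(x < K) p x * expR (- (n%:R * p x / 12)) <= 60 * h / n%:R.
Proof.
move=> h1 bh; pose c : RR := n%:R / 12.
have c0 : 0 < c by rewrite divr_gt0.
pose x0 := (Num.trunc (2 * h)).+1.
have h20 : 0 <= 2 * h by lra.
have /andP[x0l x0u] := truncn_itv h20.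
pose u x := c * p x.
have u0 x : 0 <= u x by rewrite mulr_ge0// ltW.
have ue x : u x * expR (- u x) <= 1 by exact: mul_expRN_le1.
(* The first x0 terms are at most 1 each; beyond x0 > 2 h the potential 2 exp(-u) grows at each step
   by at least the new summand. *)
have S k : \sum_(x < x0 + k) u x * expR (- u x) <= x0%:R + 2 * expR (- u (x0 + k)%N).
  elim: k => [|k IH].
    rewrite addn0; apply: (@le_trans _ _ (\sum_(x < x0) (1 : RR))).
      by apply: ler_sum => x _; exact: ue.
    by rewrite sumr_const card_ord lerDl mulr_ge0// expR_ge0.
  rewrite addnS big_ord_recr /=; set y := (x0 + k)%N.
  have half : u y.+1 <= u y / 2.
    have yh : 2 * h <= y.+1%:R.
      by apply: le_trans (ltW x0u) _; rewrite ler_nat ltnS (leq_trans (leq_addr k _))// leqnSn.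
    have py := pS y; have bpy : b y * p y <= h * p y by rewrite ler_wpM2r.
    have : 2 * h * p y.+1 <= h * p y.
      apply: le_trans bpy; rewrite -py ler_wpM2r//.
    have h0 : 0 < h by lra.
    rewrite [2 * h]mulrC -mulrA ler_pM2l// /u => pp.
    have := ler_wpM2l (ltW c0) pp; lra.
  have e1 : expR (- u y) * (1 + u y / 2) <= expR (- u y.+1).
    apply: (@le_trans _ _ (expR (- u y) * expR (u y / 2))).
      by rewrite ler_wpM2l ?expR_ge0// expR_ge1Dx.
    by rewrite -expRD ler_expR; lra.
  lra.
have all : \sum_(x < K) u x * expR (- u x) <= x0%:R + 2.
  apply: (@le_trans _ _ (\sum_(x < x0 + K) u x * expR (- u x))).
    rewrite addnC big_split_ord /= lerDl sumr_ge0// => x _.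
    by rewrite mulr_ge0// expR_ge0.
  apply: le_trans (S K) _; rewrite lerD2l.
  have : expR (- u (x0 + K)%N) <= 1 by rewrite expR_le1 oppr_le0.
  lra.
rewrite ler_pdivlMr//.
have -> : (\sum_(x < K) p x * expR (- (n%:R * p x / 12))) * n%:R
   = 12 * \sum_(x < K) u x * expR (- u x).
  rewrite mulr_suml mulr_sumr; apply: eq_bigr => x _.
  rewrite /u /c (_ : n%:R / 12 * p x = n%:R * p x / 12); last by ring.
  by field.
(* Then 12 (x0 + 2) <= 12 (2 h + 3) <= 60 h, because h >= 1. *)
have : x0%:R <= 2 * h + 1 by rewrite /x0 -[_.+1%:R]natr1 lerD2r.
lra.
Qed.

(** Against the subexponential case one factor M becomes h in both sums: the variance uses b <= h,
    and the exponential sum is O(h / n) rather than O(M / n). The result is M^2 h / n with M = 5 h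
    r, hence 25 h^3 r^2 / n. *)
Lemma bounded_bound h : 1 <= h -> s = 2 * h -> (forall x, b x <= h) ->
  (\esum_(x in [set: nat]) (p x * expR (x%:R * ln (ln n%:R)))%:E
    <= (expR (h * (ln n%:R - 1)))%:E)%E ->
  (\esum_(xs in [set: n.-tuple nat]) ((wt (p := p) xs)%:E
     * \esum_(x in [set: nat]) (p x * (est xs x - b x) ^+ 2)%:E)
   <= (25 * (16 * 6 + 21 * 60 + 1 + tail_const K0 1)
       * h ^+ 3 / n%:R * (ln n%:R / ln (ln n%:R)) ^+ 2)%:E)%E.
Proof.
move=> h1 sh bh HZ.
have L1 := ln_nat_gt1 n_ge3; set L := ln n%:R in L1 HZ *.
have l0 : 0 < ln L by rewrite ln_gt0.
have lL : ln L <= L by rewrite ltW// ln_sublinear//; lra.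
set r := L / ln L.
have r1 : 1 <= r by rewrite ler_pdivlMr// mul1r.
(* Since M ln L = 5 h L, Markov's inequality leaves exp(-5 h L + h (L - 1)) <= exp(-4 h L) <= n^-4,
   using h >= 1. *)
pose M := 5 * h * r.
have s1 := s_ge1; have K00 := K0_ge0; have s0 : 0 < s by lra.
have hM : h <= M by rewrite /M; nra.
have M1 : 1 <= M by lra.
have sM : s <= M by rewrite sh /M; nra.
have M0 : 0 <= M by lra.
have HQ : (\esum_(x in [set: nat]) (p x * ((M < x%:R) || (M < b x))%:R)%:E
   <= (1 / n%:R ^+ 4)%:E)%E.
  have eM : expR (- (M * ln L)) * expR (h * (L - 1)) <= 1 / n%:R ^+ 4.
    rewrite mul1r -(expRN_ln_nat 4 n_gt0) -/L -expRD ler_expR.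
    have -> : M * ln L = 5 * h * L by rewrite /M /r; field; rewrite gt_eqF.
    nra.
  apply: le_trans (_ : _ <= (expR (- (M * ln L)) * expR (h * (L - 1)))%:E)%E _; last first.
    by rewrite lee_fin.
  apply: le_esumZ HZ; rewrite ?expR_ge0//.
    by move=> x; rewrite mulr_ge0 ?expR_ge0.
  move=> x; rewrite [leRHS]mulrCA ler_wpM2l// -expRD.
  have -> : (M < b x) = false by apply/negbTE; rewrite -leNgt (le_trans (bh x)).
  rewrite orbF; case: ltP => [Mx|_] /=; last by rewrite expR_ge0.
  rewrite -[leLHS]expR0 ler_expR; nra.
have [K KM bnd] := sequence_bound p_ge0 p_sum1 bF pS n_gt0 M0 s0 HX Hb HQ est_erm.
apply: le_trans bnd _; rewrite lee_fin -/(tail_const _ _).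
have T0 : 0 <= tail_const K0 1 by apply: tail_const_ge0.
set T := tail_const _ _ in T0 *.
have nI : 0 < (n%:R)^-1 :> RR by rewrite invr_gt0.
have h0 : 0 <= h by lra.
apply: (@le_trans _ _ ((16 * 6 + 21 * 60 + 1 + T) * (M ^+ 2 * h) / n%:R)); last first.
  by rewrite le_eqVlt; apply/orP; left; apply/eqP; rewrite /M; ring.
rewrite [leRHS](_ : _ = (16 * 6 + 21 * 60) * (M ^+ 2 * h) / n%:R
  + (1 + T) * (M ^+ 2 * h) / n%:R); last by ring.
apply: lerD.
  rewrite big_split /= -!mulr_sumr.
  have KM2 : K%:R <= 2 * M by apply: card_le_threshold => // x /KM[].
  have S1 : \sum_(x < K) b x * (x.+1%:R + b x) <= 2 * M * (h * (3 * M)).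
    apply: (@le_trans _ _ (\sum_(x < K) (h * (3 * M)))).
      apply: ler_sum => x _; have [xM bM] := KM x (ltn_ord x).
      have b0 := b_ge0 x.
      apply: ler_pM => //; first by rewrite addr_ge0.
      by rewrite -natr1; lra.
    rewrite sumr_const card_ord -[_ *+ K]mulr_natl ler_wpM2r//.
    by rewrite mulr_ge0// mulr_ge0.
  have S2 := sum_exp_decay K h1 bh.
  have c1 : 0 <= 16 / n%:R :> RR by rewrite divr_ge0// ltW.
  have c2 : 0 <= 21 * M ^+ 2 := mulr_ge0 (ler0n _ _) (sqr_ge0 M).
  have := ler_wpM2l c1 S1; have := ler_wpM2l c2 S2; lra.
apply: ler_wpM2r; first exact: ltW.
have M2h : M ^+ 2 <= M ^+ 2 * h by rewrite ler_peMr// sqr_ge0.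
have s2M : s ^+ 2 <= M ^+ 2 * h.
  by apply: le_trans M2h; rewrite lerXn2r ?nnegrE// ltW.
rewrite [leRHS](_ : _ = M ^+ 2 * h + T * (M ^+ 2 * h)); last by ring.
by rewrite mulr1; apply: lerD => //; exact: ler_wpM2l.
Qed.

End FinalBounds.

(** * Poisson mixtures *)

Definition nonneg_reals : set RR := [set t : RR | 0 <= t].

Lemma measurable_nonneg_reals : measurable (nonneg_reals : set (measurableTypeR RR)).
Proof.
rewrite (_ : nonneg_reals = `[0, +oo[%classic); first exact: measurable_itv.
by apply/seteqP; split => t /=; rewrite in_itv/= andbT.
Qed.

(** Both sides name [measurableTypeR RR], the measurable structure on which priors are defined. *)
Definition borel_fun (f : RR -> RR) : Prop :=
  @measurable_fun _ _ (measurableTypeR RR) (measurableTypeR RR) setT f.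

Lemma borel_fun_id : borel_fun id. Proof. exact: measurable_id. Qed.

Lemma borel_fun_cst c : borel_fun (fun=> c). Proof. exact: measurable_cst. Qed.

Lemma borel_funM f g : borel_fun f -> borel_fun g -> borel_fun (fun t => f t * g t).
Proof. exact: (@measurable_funM _ (measurableTypeR RR) RR setT f g). Qed.

Lemma borel_funD f g : borel_fun f -> borel_fun g -> borel_fun (fun t => f t + g t).
Proof. exact: (@measurable_funD _ (measurableTypeR RR) RR setT f g). Qed.

Lemma borel_funN f : borel_fun f -> borel_fun (fun t => - f t).
Proof. exact: (@measurable_funN _ (measurableTypeR RR) RR setT f). Qed.

Lemma borel_funX f n : borel_fun f -> borel_fun (fun t => f t ^+ n).
Proof. exact: (@measurable_funX _ (measurableTypeR RR) RR setT f n). Qed.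

Lemma borel_fun_expR f : borel_fun f -> borel_fun (fun t => expR (f t)).
Proof.
move=> mf; exact: (@measurableT_comp _ _ _ (measurableTypeR RR)
  (measurableTypeR RR) (measurableTypeR RR) expR setT f (@measurable_expR RR) mf).
Qed.

Lemma borel_funB_id c : borel_fun (fun t => c - t).
Proof.
have mN : borel_fun (fun t => - t) by exact: (@borel_funN id borel_fun_id).
exact: (borel_funD (borel_fun_cst c) mN).
Qed.

Lemma measurable_poi x : borel_fun (poi ^~ x).
Proof.
apply: borel_funM; last exact: borel_fun_cst.
by apply: borel_funM; [apply: borel_fun_expR; exact: borel_funN borel_fun_id|exact: borel_funX borel_fun_id].
Qed.

Lemma poi_ge0 t x : 0 <= t -> 0 <= poi t x.
Proof. by move=> t0; rewrite /poi !mulr_ge0 ?expR_ge0 ?exprn_ge0 ?invr_ge0. Qed.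

Lemma poiS t x : x.+1%:R * poi t x.+1 = t * poi t x.
Proof.
have f0 : x`!%:R != 0 :> RR by rewrite pnatr_eq0 -lt0n fact_gt0.
rewrite /poi factS natrM exprS; field.
by rewrite f0 nat1r pnatr_eq0.
Qed.

Lemma esum_exp_series (y : RR) : 0 <= y ->
  (\esum_(x in [set: nat]) (y ^+ x / x`!%:R)%:E = (expR y)%:E)%E.
Proof.
move=> y0; rewrite -nneseries_esumT; last first.
  by move=> x; rewrite lee_fin divr_ge0 ?exprn_ge0.
rewrite expRE -EFin_lim; last first.
  rewrite /pseries/=; under eq_fun do rewrite mulrC.
  exact: is_cvg_series_exp_coeff.
apply/congr_lim/funext => n/=; rewrite /pseries/= /series/= -sumEFin//.
by under eq_bigr do rewrite mulrC.
Qed.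

Lemma esum_poi_expR t (lam : RR) : 0 <= t ->
  (\esum_(x in [set: nat]) (poi t x * expR (x%:R * lam))%:E
   = (expR ((expR lam - 1) * t))%:E)%E.
Proof.
move=> t0; have y0 : 0 <= t * expR lam by rewrite mulr_ge0// expR_ge0.
transitivity ((expR (- t))%:E * \esum_(x in [set: nat]) ((t * expR lam) ^+ x / x`!%:R)%:E)%E.
  rewrite -esumZl ?expR_ge0//; last first.
    by move=> x; rewrite lee_fin divr_ge0 ?exprn_ge0.
  apply: eq_esum => x _; rewrite -EFinM; congr EFin.
  by rewrite /poi expRM_natl exprMn; ring.
rewrite esum_exp_series// -EFinM -expRD; congr (expR _)%:E; ring.
Qed.

Lemma esum_poi t : 0 <= t -> (\esum_(x in [set: nat]) (poi t x)%:E = 1)%E.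
Proof.
move=> t0; have := esum_poi_expR 0 t0; rewrite expR0 subrr mul0r expR0 => <-.
by apply: eq_esum => x _; rewrite mulr0 expR0 mulr1.
Qed.

Lemma poi_le1 t x : 0 <= t -> poi t x <= 1.
Proof.
by move=> t0; exact: pmf_le1 (esum_poi t0) x.
Qed.

Section Mixture.
Variable pi : prior.
Hypothesis pi_pos : pi nonneg_reals = 1%E.

Local Notation D := nonneg_reals.
Local Notation mD := measurable_nonneg_reals.

Definition pint (f : RR -> RR) : \bar RR := (\int[pi]_(t in D) (f t)%:E)%E.

Let mE (f : RR -> RR) : borel_fun f ->
  measurable_fun (D : set (measurableTypeR RR)) (fun t => (f t)%:E).
Proof.
by move=> mf; apply/measurable_EFinP; apply: measurable_funTS.
Qed.

Let e0 (f : RR -> RR) : (forall t, 0 <= t -> 0 <= f t) ->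
  forall t, D t -> (0 <= (f t)%:E)%E.
Proof. by move=> f0 t t0; rewrite lee_fin f0. Qed.

Lemma pint_ge0 f : (forall t, 0 <= t -> 0 <= f t) -> (0 <= pint f)%E.
Proof. by move=> f0; apply: integral_ge0 => t t0; rewrite lee_fin f0. Qed.

Lemma pintD f g : borel_fun f -> borel_fun g ->
  (forall t, 0 <= t -> 0 <= f t) -> (forall t, 0 <= t -> 0 <= g t) ->
  pint (fun t => f t + g t) = (pint f + pint g)%E.
Proof.
move=> mf mg f0 g0.
exact: (ge0_integralD pi mD (e0 f0) (mE mf) (e0 g0) (mE mg)).
Qed.

Lemma pintZ c f : 0 <= c -> borel_fun f -> (forall t, 0 <= t -> 0 <= f t) ->
  pint (fun t => c * f t) = (c%:E * pint f)%E.
Proof.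
by move=> c0 mf f0; apply: (@ge0_integralZl _ _ _ pi _ mD _ (mE mf) c%:E (e0 f0)).
Qed.

Lemma le_pint f g : borel_fun f -> borel_fun g -> (forall t, 0 <= t -> 0 <= f t) ->
  (forall t, 0 <= t -> f t <= g t) -> (pint f <= pint g)%E.
Proof.
move=> mf mg f0 fg; apply: (ge0_le_integral pi mD (e0 f0) (mE mf) (mE mg)).
by move=> t t0; rewrite lee_fin fg.
Qed.

Lemma eq_pint f g : (forall t, 0 <= t -> f t = g t) -> pint f = pint g.
Proof. by move=> fg; apply: eq_integral => t /set_mem t0; rewrite fg. Qed.

Lemma pint_cst (c : RR) : pint (fun=> c) = c%:E.
Proof.
rewrite /pint (integral_cst pi mD c%:E) -[RHS]mule1; congr (_ * _)%E.
exact: pi_pos.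
Qed.

Lemma esum_pint (f : nat -> RR -> RR) : (forall x, borel_fun (f x)) ->
  (forall x t, 0 <= t -> 0 <= f x t) ->
  (\esum_(x in [set: nat]) pint (f x)
   = \int[pi]_(t in D) (\esum_(x in [set: nat]) (f x t)%:E))%E.
Proof.
move=> mf f0; rewrite -nneseries_esumT; last by move=> x; apply: pint_ge0; exact: f0.
rewrite -(integral_nneseries pi mD (fun x => mE (mf x)) (fun x => e0 (f0 x))).
apply: eq_integral => t /set_mem t0; rewrite nneseries_esumT// => x.
by rewrite lee_fin f0.
Qed.

Lemma pint_poi x : pint (poi ^~ x) = (pmix pi x)%:E.
Proof.
rewrite /pint /pmix fineK// ge0_fin_numE; last first.
  by apply: pint_ge0 => t t0; exact: poi_ge0.
apply: (@le_lt_trans _ _ (pint (fun=> 1))); last by rewrite pint_cst ltry.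
apply: le_pint (measurable_poi x) (borel_fun_cst 1) _ _ => t t0.
  exact: poi_ge0.
exact: poi_le1.
Qed.

Lemma pmix_ge0 x : 0 <= pmix pi x.
Proof.
by rewrite -lee_fin -pint_poi; apply: pint_ge0 => t t0; exact: poi_ge0.
Qed.

Lemma esum_pmix_expR (lam : RR) :
  (\esum_(x in [set: nat]) (pmix pi x * expR (x%:R * lam))%:E
   = pint (fun t => expR ((expR lam - 1) * t)))%E.
Proof.
transitivity (\esum_(x in [set: nat]) pint (fun t => expR (x%:R * lam) * poi t x)).
  apply: eq_esum => x _; rewrite pintZ ?expR_ge0//.
  - by rewrite pint_poi -EFinM mulrC.
  - exact: measurable_poi.
  - by move=> t t0; exact: poi_ge0.
rewrite esum_pint; first last.
- by move=> x t t0; rewrite mulr_ge0 ?expR_ge0// poi_ge0.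
- by move=> x; apply: measurable_funM => //; exact: measurable_poi.
apply: eq_integral => t /set_mem t0; rewrite -esum_poi_expR//.
by apply: eq_esum => x _; rewrite mulrC.
Qed.

Lemma pmix_sum1 : (\esum_(x in [set: nat]) (pmix pi x)%:E = 1)%E.
Proof.
have := esum_pmix_expR 0; rewrite expR0 subrr.
rewrite [RHS](@eq_pint _ (fun=> 1)) ?pint_cst; last first.
  by move=> t _; rewrite mul0r expR0.
by move=> <-; apply: eq_esum => x _; rewrite mulr0 expR0 mulr1.
Qed.

(* [t * poi t x = (x + 1) * poi t (x + 1)], so every moment is a value of [pmix]. *)
Lemma pint_poi_sqr x g : 0 <= g ->
  pint (fun t => poi t x * (g - t) ^+ 2) =
  (g ^+ 2 * pmix pi x - 2 * g * (x.+1%:R * pmix pi x.+1)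
   + x.+1%:R * (x.+2%:R * pmix pi x.+2))%:E.
Proof.
move=> g0; set A := pint _.
have mp y := measurable_poi y; have p0 y t (t0 : 0 <= t) := poi_ge0 y t0.
have g1 : 0 <= 2 * g * x.+1%:R by rewrite !mulr_ge0.
have h1 : 0 <= x.+1%:R * x.+2%:R :> RR by rewrite mulr_ge0.
(* The cross term stands on the left so that every integrand is nonnegative; being finite, it is
   subtracted at the end. *)
have e : (A + (2 * g * x.+1%:R * pmix pi x.+1)%:E
    = (g ^+ 2 * pmix pi x)%:E + (x.+1%:R * x.+2%:R * pmix pi x.+2)%:E)%E.
  rewrite !(EFinM (_ * _)) EFinM -!pint_poi -!pintZ// ?sqr_ge0//;
    try by move=> t t0; exact: p0.
  rewrite -!pintD//.
  - apply: eq_pint => t t0.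
    have e1 := poiS t x; have e2 := poiS t x.+1.
    rewrite -[2 * g * x.+1%:R * _]mulrA e1 -[x.+1%:R * x.+2%:R * _]mulrA e2.
    by rewrite [x.+1%:R * (t * _)]mulrCA e1; ring.
  - by apply: borel_funM (mp _); exact: borel_fun_cst.
  - by apply: borel_funM (mp _); exact: borel_fun_cst.
  - by move=> t t0; rewrite mulr_ge0 ?sqr_ge0// p0.
  - by move=> t t0; rewrite mulr_ge0// p0.
  - exact: borel_funM (mp _) (borel_funX 2 (borel_funB_id g)).
  - by apply: borel_funM (mp _); exact: borel_fun_cst.
  - by move=> t t0; rewrite mulr_ge0 ?sqr_ge0// p0.
  - by move=> t t0; rewrite mulr_ge0// p0.
move/eqP: e; rewrite -EFinD eq_sym -sube_eq//; last by rewrite fin_num_adde_defl.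
by move=> /eqP <-; rewrite -EFinB; congr EFin; ring.
Qed.

End Mixture.

(** * The Bayes rule *)

Section BayesRule.
Variable pi : prior.
Hypothesis pi_pos : pi nonneg_reals = 1%E.

Local Notation p := (pmix pi).
Local Notation b := (bayes pi).

(** This family of inequalities in g plays the part of Cauchy-Schwarz: a large g yields
    [bayes_mul_pmix], and g = b(x) yields monotonicity of the Bayes rule. *)
Lemma pmix_quad_ge0 x g : 0 <= g ->
  0 <= g ^+ 2 * p x - 2 * g * (x.+1%:R * p x.+1) + x.+1%:R * (x.+2%:R * p x.+2).
Proof.
move=> g0; rewrite -lee_fin -pint_poi_sqr//; apply: pint_ge0 => t t0.
by rewrite mulr_ge0 ?sqr_ge0// poi_ge0.
Qed.

Lemma bayes_ge0 x : 0 <= b x.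
Proof. by rewrite /bayes divr_ge0 ?mulr_ge0 ?pmix_ge0. Qed.

Lemma bayes_mul_pmix x : x.+1%:R * p x.+1 = b x * p x.
Proof.
have [px|px] := eqVneq (p x) 0; last by rewrite /bayes divfK.
rewrite px mulr0; set a := x.+1%:R * p x.+1.
have a0 : 0 <= a by rewrite mulr_ge0 ?pmix_ge0.
apply/eqP; case: eqP => // /eqP anz.
have {anz}a0 : 0 < a by rewrite lt_neqAle eq_sym anz.
set c := x.+1%:R * (x.+2%:R * p x.+2).
have c0 : 0 <= c by rewrite !mulr_ge0 ?pmix_ge0.
(* If p(x) = 0 but a > 0, this g makes the quadratic equal to -2 (c + 1) + c < 0. *)
have g0 : 0 <= (c + 1) / a by rewrite divr_ge0 ?addr_ge0// ltW.
have := pmix_quad_ge0 x g0; rewrite -/c -/a px mulr0 sub0r.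
rewrite -mulrA divfK ?gt_eqF//; lra.
Qed.

(** At g = b(x) the quadratic collapses to (b(x+1) - b(x)) b(x) p(x). If p(x+1) = 0, then b(x) = 0
    and there is nothing to compare. *)
Lemma bayes_inF : inF b.
Proof.
split; first exact: bayes_ge0.
suff mono x : b x <= b x.+1.
  move=> x y /subnK <-; elim: (y - x)%N => [|k IH]; first by rewrite add0n.
  by rewrite addSn; apply: le_trans IH (mono _).
have [px1|px1] := eqVneq (p x.+1) 0.
  by rewrite {1}/bayes px1 mulr0 mul0r bayes_ge0.
have p1 : 0 < p x.+1 by rewrite lt_neqAle eq_sym px1 pmix_ge0.
have := pmix_quad_ge0 x (bayes_ge0 x).
rewrite [x.+2%:R * _]bayes_mul_pmix [x.+1%:R * (b x.+1 * _)]mulrCA.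
rewrite bayes_mul_pmix => q.
have {q}q : b x * (b x * p x) <= b x.+1 * (b x * p x) by lra.
have bp : 0 < b x * p x by rewrite -bayes_mul_pmix mulr_gt0.
by rewrite -(ler_pM2r bp).
Qed.

Lemma pint_bayes_decomp x g : 0 <= g ->
  (pint pi (fun t => (poi t x * (g - t) ^+ 2)%R)
   = pint pi (fun t => (poi t x * (b x - t) ^+ 2)%R) + (p x * (g - b x) ^+ 2)%:E)%E.
Proof.
move=> g0; rewrite !pint_poi_sqr ?bayes_ge0// -EFinD; congr EFin.
by rewrite bayes_mul_pmix; ring.
Qed.

Let msq x (g : RR) : borel_fun (fun t => poi t x * (g - t) ^+ 2).
Proof.
exact: borel_funM (measurable_poi x) (borel_funX 2 (borel_funB_id g)).
Qed.

Let sq0 x g t : 0 <= t -> 0 <= poi t x * (g - t) ^+ 2.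
Proof. by move=> t0; rewrite mulr_ge0 ?sqr_ge0// poi_ge0. Qed.

Lemma riskE (g : nat -> RR) : risk pi g
  = (\esum_(x in [set: nat]) pint pi (fun t => (poi t x * (g x - t) ^+ 2)%R))%E.
Proof.
by rewrite (@esum_pint pi (fun x t => poi t x * (g x - t) ^+ 2)) // => x t; exact: sq0.
Qed.

(** The Pythagorean identity, in additive form so that it remains valid when a risk is infinite. *)
Lemma risk_bayes_decomp (g : nat -> RR) : (forall x, 0 <= g x) ->
  (risk pi g = risk pi b
   + \esum_(x in [set: nat]) (p x * (g x - b x) ^+ 2)%:E)%E.
Proof.
move=> g0; rewrite !riskE -esumD; last 2 first.
- by move=> x _; apply: pint_ge0 => t; exact: sq0.
- by move=> x _; rewrite lee_fin mulr_ge0 ?sqr_ge0// pmix_ge0.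
by apply: eq_esum => x _; exact: pint_bayes_decomp.
Qed.

(* Jensen's inequality, by integrating the tangent line of [exp] at [bayes pi x]
   against [poi t x]. *)
Lemma esum_pmix_bayes_expR (lam : RR) : 0 <= lam ->
  (\esum_(x in [set: nat]) (p x * expR (lam * b x))%:E
   <= pint pi (fun t => expR (lam * t)%R))%E.
Proof.
move=> lam0.
have me : borel_fun (fun t => expR (lam * t)).
  by apply: borel_fun_expR; apply: borel_funM (borel_fun_cst _) borel_fun_id.
have mpe x : borel_fun (fun t => poi t x * expR (lam * t)).
  exact: borel_funM (measurable_poi x) me.
have pe0 x t : 0 <= t -> 0 <= poi t x * expR (lam * t).
  by move=> t0; rewrite mulr_ge0 ?expR_ge0// poi_ge0.
have -> : pint pi (fun t => expR (lam * t))
    = (\esum_(x in [set: nat]) pint pi (fun t => (poi t x * expR (lam * t))%R))%E.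
  rewrite (@esum_pint pi (fun x t => poi t x * expR (lam * t)))//.
  apply: eq_integral => t /set_mem t0.
  under eq_esum do rewrite mulrC EFinM.
  rewrite esumZl ?expR_ge0//; last by move=> x; rewrite lee_fin poi_ge0.
  by rewrite esum_poi// mule1.
apply: le_esum => x _; set B := b x; set e := expR (lam * B).
have e0 : 0 <= e by exact: expR_ge0.
have B0 : 0 <= B by exact: bayes_ge0.
have eB : 0 <= e * lam * B by rewrite mulr_ge0// mulr_ge0.
have eS : 0 <= e * lam * x.+1%:R by rewrite mulr_ge0// mulr_ge0.
have mp y := measurable_poi y; have p0 y t (t0 : 0 <= t) := poi_ge0 y t0.
have mc c y : borel_fun (fun t => c * poi t y) by exact: borel_funM (borel_fun_cst c) (mp y).
(* The tangent line has a negative constant part; moving it to the right keeps both integrands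
   nonnegative. *)
have key : (pint pi (fun t => (e * poi t x + e * lam * x.+1%:R * poi t x.+1)%R)
   <= pint pi (fun t => (poi t x * expR (lam * t) + e * lam * B * poi t x)%R))%E.
  apply: le_pint.
  - exact: borel_funD.
  - exact: borel_funD.
  - by move=> t t0; rewrite addr_ge0// mulr_ge0// p0.
  - move=> t t0; have := poiS t x => pS.
    have tang : e * (1 + lam * (t - B)) <= expR (lam * t).
      rewrite (_ : lam * t = lam * B + lam * (t - B)); last by ring.
      by rewrite expRD ler_wpM2l// expR_ge1Dx.
    have := ler_wpM2l (p0 x t t0) tang.
    rewrite -[e * lam * x.+1%:R * _]mulrA pS; lra.
move: key; rewrite !pintD//; 
  try by move=> t t0; apply: mulr_ge0; rewrite ?expR_ge0 ?(p0 _ t t0).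
rewrite !pintZ//; try by move=> t t0; exact: p0.
rewrite !pint_poi// -!EFinM -EFinD.
have -> : e * p x + e * lam * x.+1%:R * p x.+1
   = p x * e + e * lam * B * p x.
  by rewrite -[e * lam * x.+1%:R * _]mulrA bayes_mul_pmix -/B; ring.
by rewrite EFinD leeD2rE.
Qed.

(** The Bayes rule does at least as well as the zero estimator, whose risk is the second moment of
    the prior. *)
Lemma risk_bayes_fin (s K0 : RR) : 0 < s ->
  (pint pi (fun t => expR (t / (2 * s))%R) <= K0%:E)%E ->
  risk pi b \is a fin_num.
Proof.
move=> s0 HK.
have me : borel_fun (fun t => expR (t / (2 * s))).
  by apply: borel_fun_expR; apply: borel_funM borel_fun_id (borel_fun_cst _).
rewrite ge0_fin_numE; last first.
  by rewrite riskE; apply: esum_ge0 => x _; apply: pint_ge0 => t; exact: sq0.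
apply: (@le_lt_trans _ _ (risk pi (fun=> 0))).
  rewrite [leRHS]risk_bayes_decomp// leeDl//.
  by apply: esum_ge0 => x _; rewrite lee_fin mulr_ge0 ?sqr_ge0// pmix_ge0.
apply: (@le_lt_trans _ _ (pint pi (fun t => (8 * s ^+ 2) * expR (t / (2 * s))))).
  rewrite /risk.
  apply: (@le_trans _ _ (pint pi (fun t => t ^+ 2))).
    rewrite le_eqVlt; apply/orP; left; apply/eqP.
    apply: eq_integral => t /set_mem t0.
    under eq_esum do rewrite sub0r sqrrN mulrC EFinM.
    rewrite esumZl ?sqr_ge0//; last by move=> x; rewrite lee_fin poi_ge0.
    by rewrite esum_poi// mule1.
  apply: le_pint.
  - exact: borel_funX borel_fun_id.
  - exact: borel_funM (borel_fun_cst _) me.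
  - by move=> t t0; exact: sqr_ge0.
  - move=> t t0; have s2 : 0 < 2 * s by rewrite mulr_gt0.
    have y0 : 0 <= t / (2 * s) by rewrite divr_ge0// ltW.
    have := ler_wpM2l (exprn_ge0 2 (ltW s2)) (expR_ge_sqr y0).
    rewrite -exprMn mulrC divfK ?gt_eqF//.
    by move=> /le_trans; apply; rewrite le_eqVlt; apply/orP; left; apply/eqP; ring.
have c8 : 0 <= 8 * s ^+ 2 by rewrite mulr_ge0 ?sqr_ge0.
have e0 t : 0 <= t -> 0 <= expR (t / (2 * s)) by move=> _; exact: expR_ge0.
rewrite (pintZ pi c8 me e0).
have s20 : (0 <= (8 * s ^+ 2)%:E :> \bar RR)%E by rewrite lee_fin.
apply: (@le_lt_trans _ _ ((8 * s ^+ 2)%:E * K0%:E)%E); last by rewrite -EFinM ltry.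
by apply: lee_pmul => //; exact: pint_ge0.
Qed.

(** The sample weights sum to 1, so the Bayes risk comes out of the sum unchanged; its finiteness is
    what permits cancelling it in the extended reals. *)
Lemma regretE n (est : n.-tuple nat -> nat -> RR) :
  risk pi b \is a fin_num -> (forall xs x, 0 <= est xs x) ->
  (regret pi est = \esum_(xs in [set: n.-tuple nat]) ((wt (p := p) xs)%:E
     * \esum_(x in [set: nat]) (p x * (est xs x - b x) ^+ 2)%:E))%E.
Proof.
move=> rfin est0; rewrite /regret.
have L0 xs : (0 <= \esum_(x in [set: nat]) (p x * (est xs x - b x) ^+ 2)%:E)%E.
  by apply: esum_ge0 => x _; rewrite lee_fin mulr_ge0 ?sqr_ge0// pmix_ge0.
have r0 : (0 <= risk pi b)%E.
  by rewrite riskE; apply: esum_ge0 => x _; apply: pint_ge0 => t; exact: sq0.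
have w0 xs : 0 <= wt (n := n) (p := p) xs by apply: wt_ge0 => x; exact: pmix_ge0.
have -> : (\esum_(xs in [set: n.-tuple nat])
    ((\prod_(i < n) p (tnth xs i))%:E * risk pi (est xs))
  = \esum_(xs in [set: n.-tuple nat]) ((fine (risk pi b))%:E * (wt (p := p) xs * 1)%:E
     + (wt (p := p) xs)%:E
       * \esum_(x in [set: nat]) (p x * (est xs x - b x) ^+ 2)%:E))%E.
  apply: eq_esum => xs _; rewrite risk_bayes_decomp// fineK// mulr1.
  by rewrite -/(wt xs) ge0_muleDr// [in RHS]muleC.
rewrite esumD; last 2 first.
- by move=> xs _; rewrite mule_ge0// ?lee_fin ?mulr1// fine_ge0.
- by move=> xs _; rewrite mule_ge0// lee_fin.
rewrite esumZl ?fine_ge0//; last by move=> xs; rewrite lee_fin mulr1.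
have := @expect1 RR p (@pmix_ge0 pi pi_pos) (pmix_sum1 pi_pos) n.
rewrite /expect => ->; rewrite mule1 fineK//.
by rewrite addeAC subee// add0e.
Qed.

End BayesRule.

(** * Subexponential and bounded priors *)

Lemma esum_le_partial (R : realType) (F : nat -> R) (r : R) :
  (forall k, 0 <= F k) -> (forall m, \sum_(k < m) F k <= r) ->
  (\esum_(k in [set: nat]) (F k)%:E <= r%:E)%E.
Proof.
move=> F0 Fr; rewrite -nneseries_esumT; last by move=> k; rewrite lee_fin.
apply: lime_le; first by apply: is_cvg_nneseries => k _ _; rewrite lee_fin.
by apply: nearW => m; rewrite big_mkord sumEFin lee_fin.
Qed.

Lemma geometric_sum_le3 (R : realType) (z : R) (m : nat) : 0 <= z <= 2 / 3 ->
  \sum_(k < m) z ^+ k <= 3.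
Proof.
move=> /andP[z0 z1]; elim: m => [|m IH]; first by rewrite big_ord0.
rewrite big_ord_recl expr0.
under eq_bigr do rewrite lift0 exprS.
rewrite -mulr_sumr.
have : z * \sum_(i < m) z ^+ i <= 2 / 3 * 3.
  by apply: ler_pM => //; apply: sumr_ge0 => i _; exact: exprn_ge0.
lra.
Qed.

Lemma nonneg_realsE : nonneg_reals = `[0, +oo[%classic.
Proof. by apply/seteqP; split => t /=; rewrite in_itv/= andbT. Qed.

Section SubexponentialPrior.
Variables (pi : prior) (s : RR).
Hypothesis s_gt0 : 0 < s.
Hypothesis pi_subE : subE s pi.

Lemma subE_pos : pi nonneg_reals = 1%E.
Proof. by case: pi_subE => + _; rewrite nonneg_realsE. Qed.

Let slice (k : nat) : set RR := `[k%:R * s, +oo[%classic.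

Let borel_slice k : borel_fun (\1_(slice k) : RR -> RR).
Proof.
apply: (@measurable_indic _ (measurableTypeR RR) RR setT).
exact: measurable_itv.
Qed.

Let slice_le k : (pint pi (\1_(slice k)) <= (2 * expR (- k%:R))%:E)%E.
Proof.
rewrite /pint (@integral_indic _ _ _ pi _ measurable_nonneg_reals); last first.
  exact: measurable_itv.
apply: (@le_trans _ _ (pi (slice k))).
  apply: le_measure; rewrite ?inE; last by move=> t [].
    by apply: measurableI; [exact: measurable_itv|exact: measurable_nonneg_reals].
  exact: measurable_itv.
(* The tail hypothesis concerns t > 0; at level 0 the total mass 1 <= 2 takes its place. *)
case: k => [|k].
  rewrite /slice mul0r oppr0 expR0 mulr1; case: pi_subE => -> _.
  by rewrite lee_fin ler1n.
case: pi_subE => _ /(_ (k.+1%:R * s)); rewrite mulfK ?gt_eqF//; apply.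
by rewrite mulr_gt0.
Qed.

(** A discrete layer-cake bound: t lies in the slice k = floor(t / s), where exp(t / (2 s)) <=
    exp((k + 1) / 2), and the slice has mass at most 2 exp(-k). *)
Lemma subE_exp_moment : (pint pi (fun t => expR (t / (2 * s))%R) <= 12%:E)%E.
Proof.
pose F k t := expR ((k%:R + 1) / 2) * \1_(slice k) t : RR.
have F00 k t : 0 <= F k t by rewrite mulr_ge0 ?expR_ge0// indicE ler0n.
have F0 k t : 0 <= t -> 0 <= F k t by [].
have mF k : borel_fun (F k) by exact: borel_funM (borel_fun_cst _) (borel_slice k).
have mexp : borel_fun (fun t => expR (t / (2 * s))).
  by apply: borel_fun_expR; apply: borel_funM borel_fun_id (borel_fun_cst _).
apply: (@le_trans _ _ (\esum_(k in [set: nat]) pint pi (F k))%E).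
  rewrite esum_pint//.
  apply: ge0_le_integral; first exact: measurable_nonneg_reals.
  - by move=> t t0; rewrite lee_fin expR_ge0.
  - by apply/measurable_EFinP; apply: measurable_funTS.
  - rewrite (_ : (fun t => _) = (fun t => \sum_(0 <= k <oo) (F k t)%:E)%E); last first.
      by apply/funext => t; rewrite nneseries_esumT// => k; rewrite lee_fin F00.
    apply: ge0_emeasurable_sum => [k t t0 _|k _]; first by rewrite lee_fin F00.
    by apply/measurable_EFinP; apply: measurable_funTS; exact: mF.
  move=> t t0; have ts0 : 0 <= t / s by rewrite divr_ge0// ltW.
  have /andP[kt tk] := truncn_itv ts0; set k := Num.trunc (t / s) in kt tk.
  apply: esum_ge; exists [set k]; first by split.
  rewrite fsbig_set1 lee_fin /F indicE mem_set ?mulr1; last first.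
    by rewrite /slice /= in_itv /= andbT -ler_pdivlMr.
  rewrite ler_expR natr1 invfM mulrCA mulrC ler_wpM2r//; exact: ltW.
apply: (@le_trans _ _ (\esum_(k in [set: nat])
   (2 * expR (1 / 2) * expR (- (1 / 2)) ^+ k)%:E)%E).
  apply: le_esum => k _; rewrite /F pintZ ?expR_ge0//.
  apply: (@le_trans _ _ ((expR ((k%:R + 1) / 2))%:E * (2 * expR (- k%:R))%:E)%E).
    apply: lee_pmul (slice_le k) => //.
    by apply: pint_ge0 => t _; rewrite indicE ler0n.
  rewrite -EFinM lee_fin -expRM_natl mulrCA -mulrA -!expRD.
  by rewrite ler_wpM2l// ler_expR; lra.
(* The value 12 is 4 * 3: the prefactor 2 exp(1/2) is at most 4, and the geometric series of ratio
   exp(-1/2) <= 2/3 is at most 3. *)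
have e1 := expR_ge1Dx (1 / 2 : RR); have e2 := expR_ge1Dx (- (1 / 2) : RR).
have e3 := expRxMexpNx_1 (1 / 2 : RR).
have z23 : expR (- (1 / 2)) <= 2 / 3 :> RR by have := expR_gt0 (- (1 / 2) : RR); nra.
have e4 : expR (1 / 2) <= 2 :> RR by nra.
apply: esum_le_partial => [k|m].
  by rewrite !mulr_ge0 ?expR_ge0// exprn_ge0 ?expR_ge0.
rewrite -mulr_sumr.
have z0 : 0 <= expR (- (1 / 2) : RR) <= 2 / 3 by rewrite expR_ge0.
have g3 := geometric_sum_le3 m z0.
have : 2 * expR (1 / 2) * (\sum_(k < m) expR (- (1 / 2)) ^+ k) <= 4 * 3 :> RR.
  have e0 : 0 <= 2 * expR (1 / 2) :> RR by rewrite mulr_ge0 ?expR_ge0.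
  have S0 : 0 <= \sum_(k < m) expR (- (1 / 2)) ^+ k :> RR.
    by apply: sumr_ge0 => k _; rewrite exprn_ge0 ?expR_ge0.
  by apply: ler_pM => //; lra.
lra.
Qed.

Hypothesis s_ge1 : 1 <= s.

(** The Poisson step replaces the exponent l = 1 / (4 s) by exp l - 1, which is at most 2 l = 1 / (2
    s) because s >= 1 makes l <= 1/4. This is why X is tested at half the exponent used for the
    prior. *)
Lemma subE_pmix_moment :
  (\esum_(x in [set: nat]) (pmix pi x * expR (x%:R / (4 * s)))%:E <= 12%:E)%E.
Proof.
rewrite (esum_pmix_expR subE_pos (4 * s)^-1); apply: le_trans subE_exp_moment.
have mexp (c : RR) : borel_fun (fun t => expR (c * t)).
  by apply: borel_fun_expR; apply: borel_funM (borel_fun_cst _) borel_fun_id.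
have mexp' : borel_fun (fun t => expR (t / (2 * s))).
  by apply: borel_fun_expR; apply: borel_funM borel_fun_id (borel_fun_cst _).
apply: le_pint (mexp _) mexp' _ _ => t t0; first exact: expR_ge0.
 rewrite ler_expR [leRHS]mulrC ler_wpM2r//.
have s1 := s_ge1; have s0 := s_gt0.
set l := (4 * s)^-1.
have ls : l * (4 * s) = 1 by rewrite mulVf// gt_eqF// mulr_gt0.
have -> : (2 * s)^-1 = 2 * l by rewrite /l; field; rewrite gt_eqF.
have l0 : 0 < l by rewrite invr_gt0 mulr_gt0.
have l4 : l <= 1 / 4 by nra.
have := expR_ge1Dx (- l); have := expRxMexpNx_1 l; have := expR_gt0 l; nra.
Qed.

Lemma subE_bayes_moment :
  (\esum_(x in [set: nat]) (pmix pi x * expR (bayes pi x / (2 * s)))%:E <= 12%:E)%E.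
Proof.
have l0 : 0 <= (2 * s)^-1 by rewrite invr_ge0 mulr_ge0// ltW.
apply: (@le_trans _ _ (\esum_(x in [set: nat])
  (pmix pi x * expR ((2 * s)^-1 * bayes pi x))%:E)%E).
  by apply: le_esum => x _; rewrite [_ / _]mulrC.
apply: le_trans (esum_pmix_bayes_expR subE_pos l0) _.
apply: le_trans subE_exp_moment; rewrite le_eqVlt; apply/orP; left; apply/eqP.
by apply: eq_pint => t _; rewrite mulrC.
Qed.

Lemma subE_risk_fin : risk pi (bayes pi) \is a fin_num.
Proof. exact: (risk_bayes_fin subE_pos s_gt0 subE_exp_moment). Qed.

End SubexponentialPrior.

Lemma subE_mono s s' pi : 0 < s -> s <= s' -> subE s pi -> subE s' pi.
Proof.
move=> s0 ss' [pi1 tail]; split=> // t t0; apply: le_trans (tail t t0) _.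
rewrite lee_fin ler_wpM2l// ler_expR lerN2 ler_pM2l//.
by rewrite lef_pV2 ?posrE// (lt_le_trans s0).
Qed.

Section BoundedPrior.
Variables (pi : prior) (h : RR).
Hypothesis h_ge1 : 1 <= h.
Hypothesis pi_supp : supp_in h pi.

Let h_ge0 : 0 <= h. Proof. exact: le_trans h_ge1. Qed.
Let mI : measurable (`[0, h]%classic : set (measurableTypeR RR)).
Proof. exact: measurable_itv. Qed.

Lemma supp_in_pos : pi nonneg_reals = 1%E.
Proof.
apply/eqP; rewrite eq_le; apply/andP; split.
  apply: probability_le1; exact: measurable_nonneg_reals.
rewrite -pi_supp; apply: le_measure; rewrite ?inE.
- exact: mI.
- exact: measurable_nonneg_reals.
- by move=> t /=; rewrite in_itv/= => /andP[].
Qed.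

Let pi_out : pi (~` `[0, h]%classic) = 0%E.
Proof. by rewrite probability_setC// pi_supp subee. Qed.

Lemma le_pint_supp (f g : RR -> RR) : borel_fun f -> borel_fun g ->
  (forall t, 0 <= t -> 0 <= f t) -> (forall t, 0 <= t -> 0 <= g t) ->
  (forall t, 0 <= t <= h -> f t <= g t) -> (pint pi f <= pint pi g)%E.
Proof.
move=> mf mg f0 g0 fg; apply: ae_ge0_le_integral.
- exact: measurable_nonneg_reals.
- by move=> t t0; rewrite lee_fin f0.
- by apply/measurable_EFinP; apply: measurable_funTS.
- by move=> t t0; rewrite lee_fin g0.
- by apply/measurable_EFinP; apply: measurable_funTS.
exists (~` `[0, h]%classic); split => //; first exact: measurableC.
by move=> t /= nt tI; apply: nt => _; rewrite lee_fin fg.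
Qed.

(** For t <= h the bound 2 exp(-t / (2 h)) is at least 2 (1 - 1/2) = 1, and beyond h there is no
    mass. *)
Lemma supp_in_subE : subE (2 * h) pi.
Proof.
split; first by rewrite -nonneg_realsE supp_in_pos.
move=> t t0; have h0 : 0 < h by exact: lt_le_trans h_ge1.
have mt : measurable (`[t, +oo[%classic : set (measurableTypeR RR)).
  exact: measurable_itv.
have [th|ht] := leP t h.
  apply: (@le_trans _ _ 1%E); first exact: probability_le1.
  rewrite lee_fin.
  have : t / (2 * h) <= 1 / 2.
    by rewrite ler_pdivrMr ?mulr_gt0//; lra.
  have := expR_ge1Dx (- (t / (2 * h))); lra.
have -> : pi `[t, +oo[%classic = 0%E.
  apply: (@subset_measure0 _ (measurableTypeR RR) RR pi _ _ mt (measurableC mI) _ pi_out).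
  by move=> u /=; rewrite !in_itv/= andbT => tu /andP[_ uh]; lra.
by rewrite lee_fin mulr_ge0 ?expR_ge0.
Qed.

(** Integrate (x + 1) poi(t, x + 1) = t poi(t, x) <= h poi(t, x) over the support. *)
Lemma supp_in_bayes_le x : bayes pi x <= h.
Proof.
have [px|px] := eqVneq (pmix pi x) 0; first by rewrite /bayes px invr0 mulr0.
have p0 : 0 < pmix pi x by rewrite lt_neqAle eq_sym px pmix_ge0// supp_in_pos.
rewrite -(ler_pM2r p0) -bayes_mul_pmix ?supp_in_pos//.
have mp y := measurable_poi y.
rewrite -lee_fin !EFinM -!(pint_poi supp_in_pos) -!pintZ//;
  try by move=> t t0; exact: poi_ge0.
apply: le_pint_supp.
- exact: borel_funM (borel_fun_cst _) (mp _).
- exact: borel_funM (borel_fun_cst _) (mp _).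
- by move=> t t0; rewrite mulr_ge0// poi_ge0.
- by move=> t t0; rewrite mulr_ge0// poi_ge0.
by move=> t /andP[t0 th]; rewrite poiS ler_wpM2r// poi_ge0.
Qed.

Lemma supp_in_mgf (lam : RR) : 0 <= lam ->
  (\esum_(x in [set: nat]) (pmix pi x * expR (x%:R * lam))%:E
   <= (expR (h * (expR lam - 1)))%:E)%E.
Proof.
move=> lam0; rewrite (esum_pmix_expR supp_in_pos) -(pint_cst supp_in_pos).
apply: le_pint_supp.
- by apply: borel_fun_expR; apply: borel_funM (borel_fun_cst _) borel_fun_id.
- exact: borel_fun_cst.
- by move=> t _; exact: expR_ge0.
- by move=> t _; exact: expR_ge0.
move=> t /andP[t0 th]; rewrite ler_expR mulrC ler_wpM2r// subr_ge0.
by rewrite -expR0 ler_expR.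
Qed.

End BoundedPrior.

Lemma supp_in_mono h h' pi : h <= h' -> supp_in h pi -> supp_in h' pi.
Proof.
move=> hh' pi1; apply/eqP; rewrite eq_le; apply/andP; split.
  by apply: probability_le1; exact: measurable_itv.
rewrite -pi1; apply: le_measure; rewrite ?inE; try exact: measurable_itv.
by move=> t /=; rewrite !in_itv/= => /andP[-> th]; exact: le_trans hh'.
Qed.

Theorem theorem1 :
  exists C : RR, 0 < C /\
  forall (h s : RR) (n : nat), 0 < h -> 0 < s -> (3 <= n)%N ->
  forall est : n.-tuple nat -> nat -> RR,
  (forall xs, is_erm xs (est xs)) ->
  (forall pi : prior, supp_in h pi ->
     (regret pi est <= (C * Num.max 1 h ^+ 3 / n%:R
                        * (ln n%:R / ln (ln n%:R)) ^+ 2)%:E)%E) /\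
  (forall pi : prior, subE s pi ->
     (regret pi est <= (C * Num.max 1 s ^+ 3 / n%:R * (ln n%:R) ^+ 3)%:E)%E).
Proof.
pose C1 := 25 * (16 * 6 + 21 * 60 + 1 + tail_const 12 1).
pose C2 := 16 ^+ 3 * (2 * 300 + 2 * 12 + tail_const 12 (2 * 12)).
have T1 : 0 <= tail_const 12 1 by exact: tail_const_ge0 (ler0n _ _) (ler0n _ 1).
have T2 : 0 <= tail_const 12 (2 * 12).
  exact: tail_const_ge0 (ler0n _ _) (mulr_ge0 (ler0n _ _) (ler0n _ _)).
have C1_gt0 : 0 < C1 by rewrite /C1; lra.
have C2_gt0 : 0 < C2 by rewrite /C2; lra.
(* Lets C1 + C2 serve as the common constant of both bounds. *)
have widen (a c x y z : RR) : 0 <= c -> 0 <= x -> 0 <= y -> 0 <= z ->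
    a * x / y * z <= (a + c) * x / y * z.
  move=> c0 x0 y0 z0; have v0 : 0 <= y^-1 by rewrite invr_ge0.
  by do 3 apply: ler_wpM2r => //; rewrite lerDl.
exists (C1 + C2); split; first exact: addr_gt0.
move=> h s n h0 s0 n3 est erm.
have n_pos : 0 < n%:R :> RR by rewrite ltr0n (leq_trans _ n3).
have L1 := ln_nat_gt1 n3.
have est0 xs x : 0 <= est xs x by case: (erm xs) => [[f0 _] _ _ _].
split=> pi hpi.
  have h1 : 1 <= Num.max 1 h by rewrite le_max lexx.
  (* Both classes of priors grow with their parameter, so a parameter at least 1 may be assumed;
     this produces the maxima in the bounds. *)
  have {hpi}hpi : supp_in (Num.max 1 h) pi.
    by apply: supp_in_mono hpi; rewrite le_max lexx orbT.
  move: h1 hpi; set m := Num.max 1 h => m1 hpi.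
  have m2 : 1 <= 2 * m by lra.
  have m0 : 0 < 2 * m by lra.
  have sE := supp_in_subE m1 hpi.
  have pos := supp_in_pos hpi.
  rewrite (regretE pos (subE_risk_fin m0 sE) est0).
  apply: le_trans (bounded_bound (pmix_ge0 pos) (pmix_sum1 pos) (bayes_inF pos)
    (bayes_mul_pmix pos) n3 m2 (ler0n _ 12) (subE_pmix_moment m0 sE m2)
    (subE_bayes_moment m0 sE) erm m1 erefl (supp_in_bayes_le m1 hpi) _) _.
    have ll0 : 0 <= ln (ln (n%:R : RR)) by rewrite ln_ge0// ltW.
    apply: le_trans (supp_in_mgf hpi ll0) _.
    by rewrite lnK// posrE; apply: lt_trans L1.
  rewrite lee_fin; apply: widen; rewrite ?sqr_ge0 ?ltW//.
  by rewrite exprn_gt0//; lra.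
have s1 : 1 <= Num.max 1 s by rewrite le_max lexx.
have {hpi}hpi : subE (Num.max 1 s) pi.
  by apply: subE_mono hpi => //; rewrite le_max lexx orbT.
move: s1 hpi; set m := Num.max 1 s => m1 hpi.
have m0 : 0 < m by lra.
have pos := subE_pos hpi.
rewrite (regretE pos (subE_risk_fin m0 hpi) est0).
apply: le_trans (subexp_bound (pmix_ge0 pos) (pmix_sum1 pos) (bayes_inF pos)
  (bayes_mul_pmix pos) n3 m1 (ler0n _ 12) (subE_pmix_moment m0 hpi m1)
  (subE_bayes_moment m0 hpi) erm) _.
rewrite lee_fin [C1 + C2]addrC; apply: widen; rewrite ?ltW ?exprn_gt0//.
by apply: lt_trans L1.
Qed.
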